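(* Suppose $\mathfrak c$ is a Kunen cardinal. Then the restriction of the supremum norm to $S(K)$ is measurable with respect to the trace of $\mathrm{Ba}(C(K),w)$ on $S(K)$.
   Context: A cardinal $\tau$ is a Kunen cardinal if $\mathcal P(\tau\times\tau)=\mathcal P(\tau)\otimes\mathcal P(\tau)$, where $\mathcal P$ denotes the power set and $\otimes$ the product $\sigma$-algebra. $\mathfrak c$ is the cardinality of the continuum. Setting. Fix a cardinal $\kappa$ with $\omega_1\le\kappa\le\mathfrak c$. Let $\lambda$ be the usual product probability measure on the Baire $\sigma$-algebra of $2^\kappa$, and let $\mathfrak B$ be its measure algebra (Baire sets modulo $\lambda$-null sets). The least element of a Boolean algebra is $\mathbf 0$; for a Boolean algebra $\mathfrak D$, $\mathfrak D^+$ is the set of its nonzero elements. Let $\mathfrak C=\mathfrak B^{\mathbb N}$ with coordinatewise operations, with elements $c=(c(n))_n$. Fix an independent family $\{N_b: b\in\mathfrak B^+\}$ of subsets of $\mathbb N$, i.e. $\bigcap_{b\in s}N_b\setminus\bigcup_{b'\in t}N_{b'}\ne\emptyset$ for all finite disjoint $s,t\subseteq\mathfrak B^+$. For $b\in\mathfrak B^+$ define $G_b\in\mathfrak C$ by $G_b(n)=b$ if $n\in N_b$ and $G_b(n)=\mathbf 0$ otherwise. Let $\mathfrak A$ be the subalgebra of $\mathfrak C$ generated by $\{G_b:b\in\mathfrak B^+\}$, and let $K$ be the Stone space of all ultrafilters on $\mathfrak A$. $C(K)$ is the Banach space of real-valued continuous functions on $K$ with the supremum norm. $\mathrm{Ba}(C(K),w)$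 is the Baire $\sigma$-algebra of the weak topology of $C(K)$, which coincides with the $\sigma$-algebra on $C(K)$ generated by $C(K)^*$. The trace of a $\sigma$-algebra $\Sigma$ on a subset $E$ is $\{A\cap E: A\in\Sigma\}$. $S(K)$ is the linear span of the characteristic functions of clopen subsets of $K$. *)

(* Defs.v *)
From HB Require Import structures.
From mathcomp Require Import all_boot all_order all_algebra generic_quotient.
From mathcomp Require Import all_classical all_reals all_analysis.

Set Implicit Arguments.
Unset Strict Implicit.
Unset Printing Implicit Defensive.

Import Order.Theory GRing.Theory Num.Theory.
Import numFieldTopology.Exports numFieldNormedType.Exports.

Local Open Scope classical_set_scope.
Local Open Scope ring_scope.

(* A type T stands for the cardinal |T|; the property below only depends on
   that cardinal. The right-hand side of the equation P(T x T) = P(T) (x) P(T)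
   is the sigma-algebra generated by all rectangles. *)
Definition Kunen_cardinal (T : Type) : Prop :=
  <<s [set A `*` B | A in [set: set T] & B in [set: set T]] >>
  = [set: set (T * T)].

Definition independent_family (J : Type) (N : J -> set nat) : Prop :=
  forall s t : set J, finite_set s -> finite_set t -> s `&` t = set0 ->
    (\bigcap_(b in s) N b) `\` (\bigcup_(b in t) N b) !=set0.

Section Baire_section.
Variables (R : realType) (T : topologicalType).

Definition Baire_generator : set (set T) :=
  [set f @^-1` B | f in [set f : T -> R | continuous f]
                 & B in (measurable : set (set R))].

Definition Baire_sigma_algebra : set (set T) := <<s Baire_generator >>.

End Baire_section.
Arguments Baire_generator : clear implicits.
Arguments Baire_sigma_algebra : clear implicits.

Definition Baire_cube (R : realType) (I : Type) : measurableType _ :=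
  g_sigma_algebraType (Baire_generator R {ptws I -> bool}).

(* The usual product probability on 2^I is the only probability on the Baire
   sigma-algebra that gives the mass 2^-n to every cylinder fixing n
   coordinates. *)
Definition usual_product_measure (R : realType) (I : Type)
    (lambda : probability (Baire_cube R I) R) : Prop :=
  forall (n : nat) (i : 'I_n -> I) (e : 'I_n -> bool), injective i ->
    lambda [set x | forall k, x (i k) = e k] = ((2^-1 : R) ^+ n)%:E.

Fact measure_algebra_display : Order.disp_t. Proof. exact: Order.Disp. Qed.

Section measure_algebra.
Context d (T : measurableType d) (R : realType).
Variable mu : {measure set T -> \bar R}.

Local Open Scope quotient_scope.

Local Notation mset := (set_type (@measurable d T)).
Implicit Types A B C : mset.

Definition ae_eqset A B : bool := `[< mu (val A `+` val B) = 0%E >].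

Let mval A : measurable (val A). Proof. exact: set_mem (valP A). Qed.

Let null_sub (A B : set T) : measurable A -> measurable B ->
  A `<=` B -> mu B = 0%E -> mu A = 0%E.
Proof. exact: subset_measure0. Qed.

Let null_setU (A B : set T) : measurable A -> measurable B ->
  mu A = 0%E -> mu B = 0%E -> mu (A `|` B) = 0%E.
Proof.
move=> mA mB A0 B0; apply/eqP; rewrite -measure_le0.
by rewrite (le_trans (measureU2 mu mA mB))//= A0 B0 adde0.
Qed.

Let measurable_setY (A B : set T) :
  measurable A -> measurable B -> measurable (A `+` B).
Proof. by move=> mA mB; apply: measurableU; exact: measurableD. Qed.

Fact ae_eqset_refl : reflexive ae_eqset.
Proof. by move=> A; apply/asboolP; rewrite setYK measure0. Qed.

Fact ae_eqset_sym : symmetric ae_eqset.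
Proof. by move=> A B; rewrite /ae_eqset setYC. Qed.

Fact ae_eqset_trans : transitive ae_eqset.
Proof.
move=> B A C /asboolP AB /asboolP BC; apply/asboolP.
apply: (@null_sub _ ((val A `+` val B) `|` (val B `+` val C))).
- exact: measurable_setY.
- by apply: measurableU; exact: measurable_setY.
- by move=> x /= [] []; case: (pselect (sval B x)); tauto.
- by apply: null_setU => //; exact: measurable_setY.
Qed.

Canonical ae_eqset_equiv :=
  EquivRel ae_eqset ae_eqset_refl ae_eqset_sym ae_eqset_trans.

Definition measure_algebra := {eq_quot ae_eqset}%qT.

HB.instance Definition _ := Choice.on measure_algebra.
HB.instance Definition _ := EqQuotient.on measure_algebra.

Definition mset_of (A : set T) (mA : measurable A) : mset :=
  exist _ A (mem_set mA).

Definition msetI A B := mset_of (measurableI _ _ (mval A) (mval B)).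
Definition msetU A B := mset_of (measurableU _ _ (mval A) (mval B)).
Definition msetC A := mset_of (measurableC (mval A)).
Definition mset0 := mset_of (@measurable0 d T).
Definition msetT := mset_of (@measurableT d T).

Definition malg_meet := lift_op2 measure_algebra msetI.
Definition malg_join := lift_op2 measure_algebra msetU.
Definition malg_compl := lift_op1 measure_algebra msetC.
Definition malg_class A : measure_algebra := \pi A.

Definition malg_bot : measure_algebra := malg_class mset0.
Definition malg_top : measure_algebra := malg_class msetT.

Let malg_class_repr a : malg_class (repr a) = a.
Proof. exact: reprK. Qed.

Let malg_ind (P : measure_algebra -> Prop) :
  (forall A, P (malg_class A)) -> forall a, P a.
Proof. by move=> PA a; rewrite -[a]malg_class_repr. Qed.

Let piE A B :
  (malg_class A = malg_class B) <-> mu (val A `+` val B) = 0%E.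
Proof.
split=> [/eqP|AB0]; first by rewrite /malg_class eqmodE => /asboolP.
by apply/eqP; rewrite eqmodE; exact/asboolP.
Qed.

Let val_repr A : mu (val (repr (malg_class A)) `+` val A) = 0%E.
Proof. by apply/piE; rewrite malg_class_repr. Qed.

Let meet_pi A B : malg_meet (malg_class A) (malg_class B) = malg_class (msetI A B).
Proof.
rewrite /malg_meet; unlock; apply/piE.
set A' := repr _; set B' := repr _.
apply: (@null_sub _ ((val A' `+` val A) `|` (val B' `+` val B))).
- exact: measurable_setY.
- by apply: measurableU; exact: measurable_setY.
- move=> x /=; case: (pselect (sval A x)); case: (pselect (sval B x));
    by case: (pselect (sval A' x)); case: (pselect (sval B' x)); tauto.
- by apply: null_setU; [exact: measurable_setY..|exact: val_repr|
    exact: val_repr].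
Qed.

Let join_pi A B : malg_join (malg_class A) (malg_class B) = malg_class (msetU A B).
Proof.
rewrite /malg_join; unlock; apply/piE.
set A' := repr _; set B' := repr _.
apply: (@null_sub _ ((val A' `+` val A) `|` (val B' `+` val B))).
- exact: measurable_setY.
- by apply: measurableU; exact: measurable_setY.
- move=> x /=; case: (pselect (sval A x)); case: (pselect (sval B x));
    by case: (pselect (sval A' x)); case: (pselect (sval B' x)); tauto.
- by apply: null_setU; [exact: measurable_setY..|exact: val_repr|
    exact: val_repr].
Qed.

Let compl_pi A : malg_compl (malg_class A) = malg_class (msetC A).
Proof.
rewrite /malg_compl; unlock; apply/piE.
set A' := repr _.
apply: (@null_sub _ (val A' `+` val A)).
- exact: measurable_setY.
- exact: measurable_setY.
- by move=> x /=; case: (pselect (sval A x)); case: (pselect (sval A' x)); tauto.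
- exact: val_repr.
Qed.

Let pi_congr A B : val A = val B -> malg_class A = malg_class B.
Proof. by move=> AB; congr malg_class; exact: val_inj. Qed.

Fact malg_meetC : commutative malg_meet.
Proof.
elim/malg_ind=> A; elim/malg_ind=> B; rewrite !meet_pi.
by apply: pi_congr; rewrite /= setIC.
Qed.

Fact malg_joinC : commutative malg_join.
Proof.
elim/malg_ind=> A; elim/malg_ind=> B; rewrite !join_pi.
by apply: pi_congr; rewrite /= setUC.
Qed.

Fact malg_meetA : associative malg_meet.
Proof.
elim/malg_ind=> A; elim/malg_ind=> B; elim/malg_ind=> C; rewrite !meet_pi.
by apply: pi_congr; rewrite /= setIA.
Qed.

Fact malg_joinA : associative malg_join.
Proof.
elim/malg_ind=> A; elim/malg_ind=> B; elim/malg_ind=> C; rewrite !join_pi.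
by apply: pi_congr; rewrite /= setUA.
Qed.

Fact malg_joinKI b a : malg_meet a (malg_join a b) = a.
Proof.
elim/malg_ind: a => A; elim/malg_ind: b => B; rewrite join_pi meet_pi.
by apply: pi_congr; rewrite /= setUC setKU.
Qed.

Fact malg_meetKU b a : malg_join a (malg_meet a b) = a.
Proof.
elim/malg_ind: a => A; elim/malg_ind: b => B; rewrite meet_pi join_pi.
by apply: pi_congr; rewrite /= setIC setKI.
Qed.

Fact malg_meetUl : left_distributive malg_meet malg_join.
Proof.
elim/malg_ind=> A; elim/malg_ind=> B; elim/malg_ind=> C.
rewrite !(join_pi, meet_pi).
by apply: pi_congr; rewrite /= setIUl.
Qed.

Fact malg_meetxx : idempotent_op malg_meet.
Proof.
by elim/malg_ind=> A; rewrite meet_pi; apply: pi_congr; rewrite /= setIid.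
Qed.

HB.instance Definition _ :=
  @Order.isMeetJoinDistrLattice.Build measure_algebra_display measure_algebra
    (fun a b => malg_meet a b == a)
    (fun a b => (b != a) && (malg_meet a b == a))
    malg_meet malg_join (fun _ _ => erefl) (fun _ _ => erefl)
    malg_meetC malg_joinC malg_meetA malg_joinA malg_joinKI malg_meetKU
    malg_meetUl malg_meetxx.

Fact malg_le0x (a : measure_algebra) : (malg_bot <= a)%O.
Proof.
rewrite leEmeet; apply/eqP; elim/malg_ind: a => A.
by rewrite [LHS]meet_pi; apply: pi_congr; rewrite /= set0I.
Qed.

Fact malg_lex1 (a : measure_algebra) : (a <= malg_top)%O.
Proof.
rewrite leEmeet; apply/eqP; elim/malg_ind: a => A.
by rewrite [LHS]meet_pi; apply: pi_congr; rewrite /= setIT.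
Qed.

HB.instance Definition _ := @Order.hasBottom.Build measure_algebra_display
  measure_algebra malg_bot malg_le0x.
HB.instance Definition _ := @Order.hasTop.Build measure_algebra_display
  measure_algebra malg_top malg_lex1.

Fact malg_joinxC (a : measure_algebra) : (a `|` malg_compl a = \top)%O.
Proof.
elim/malg_ind: a => A; rewrite compl_pi [LHS]join_pi.
by apply: pi_congr; rewrite /= setUv.
Qed.

Fact malg_meetxC (a : measure_algebra) : (a `&` malg_compl a = \bot)%O.
Proof.
elim/malg_ind: a => A; rewrite compl_pi [LHS]meet_pi.
by apply: pi_congr; rewrite /= setICr.
Qed.

HB.instance Definition _ := @Order.TBDistrLattice_hasComplement.Build
  measure_algebra_display measure_algebra malg_compl malg_joinxC malg_meetxC.

End measure_algebra.

(* D^N with the coordinatewise operations. *)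
Definition power_algebra (disp : Order.disp_t) (D : ctbDistrLatticeType disp) :=
  nat -> D.

Fact power_algebra_display : Order.disp_t. Proof. exact: Order.Disp. Qed.

Section power_algebra.
Local Open Scope order_scope.
Context (disp : Order.disp_t) (D : ctbDistrLatticeType disp).
Local Notation P := (power_algebra D).
Implicit Types f g h : P.

HB.instance Definition _ := Choice.on P.

Definition power_le f g : bool := `[< forall n, f n <= g n >].
Definition power_meet f g : P := fun n => f n `&` g n.
Definition power_join f g : P := fun n => f n `|` g n.

Fact power_le_def f g : power_le f g = (power_meet f g == f).
Proof.
apply/asboolP/eqP => [fg|fg n]; first by apply/funext => n; exact/meet_idPl.
by apply/meet_idPl; rewrite -[in RHS]fg.
Qed.

Fact power_meetC : commutative power_meet.
Proof. by move=> f g; apply/funext => n; exact: meetC. Qed.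
Fact power_joinC : commutative power_join.
Proof. by move=> f g; apply/funext => n; exact: joinC. Qed.
Fact power_meetA : associative power_meet.
Proof. by move=> f g h; apply/funext => n; exact: meetA. Qed.
Fact power_joinA : associative power_join.
Proof. by move=> f g h; apply/funext => n; exact: joinA. Qed.
Fact power_joinKI g f : power_meet f (power_join f g) = f.
Proof. by apply/funext => n; exact: joinKI. Qed.
Fact power_meetKU g f : power_join f (power_meet f g) = f.
Proof. by apply/funext => n; exact: meetKU. Qed.
Fact power_meetUl : left_distributive power_meet power_join.
Proof. by move=> f g h; apply/funext => n; exact: meetUl. Qed.
Fact power_meetxx : idempotent_op power_meet.
Proof. by move=> f; apply/funext => n; exact: meetxx. Qed.

HB.instance Definition _ :=
  @Order.isMeetJoinDistrLattice.Build power_algebra_display P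
    power_le (fun f g => (g != f) && power_le f g) power_meet power_join
    power_le_def (fun _ _ => erefl)
    power_meetC power_joinC power_meetA power_joinA power_joinKI power_meetKU
    power_meetUl power_meetxx.

Fact power_le0x f : (fun=> \bot : D) <= f :> P.
Proof. by apply/asboolP => n; exact: le0x. Qed.
Fact power_lex1 f : f <= (fun=> \top : D) :> P.
Proof. by apply/asboolP => n; exact: lex1. Qed.

HB.instance Definition _ :=
  @Order.hasBottom.Build power_algebra_display P _ power_le0x.
HB.instance Definition _ :=
  @Order.hasTop.Build power_algebra_display P _ power_lex1.

Fact power_joinxC f : f `|` ((fun n => ~` f n) : P) = \top.
Proof. by apply/funext => n; exact: joinxC. Qed.
Fact power_meetxC f : f `&` ((fun n => ~` f n) : P) = \bot.
Proof. by apply/funext => n; exact: meetxC. Qed.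

HB.instance Definition _ := @Order.TBDistrLattice_hasComplement.Build
  power_algebra_display P _ power_joinxC power_meetxC.

End power_algebra.

Section Boolean_algebra.
Context (disp : Order.disp_t) (D : ctbDistrLatticeType disp).

Definition is_subalgebra (S : set D) : Prop :=
  [/\ S \bot%O, S \top%O,
      forall a b, S a -> S b -> S (a `&` b)%O,
      forall a b, S a -> S b -> S (a `|` b)%O
    & forall a, S a -> S (~` a)%O].

Definition generated_subalgebra (G : set D) : set D := smallest is_subalgebra G.

Definition is_ultrafilter (S U : set D) : Prop :=
  [/\ U `<=` S, U \top%O /\ ~ U \bot%O,
      forall a b, U a -> U b -> U (a `&` b)%O,
      forall a b, U a -> S b -> (a <= b)%O -> U b
    & forall a, S a -> U a \/ U (~` a)%O].

Lemma generated_subalgebraP (G : set D) : is_subalgebra (generated_subalgebra G).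
Proof.
split.
- by move=> S [[]].
- by move=> S [[]].
- by move=> a b Sa Sb S SG; have [[_ _ SI _ _] _] := SG; apply: SI;
    [exact: Sa|exact: Sb].
- by move=> a b Sa Sb S SG; have [[_ _ _ SU _] _] := SG; apply: SU;
    [exact: Sa|exact: Sb].
- by move=> a Sa S SG; have [[_ _ _ _ SC] _] := SG; apply: SC; exact: Sa.
Qed.

(* The ultrafilters are those of the Boolean algebra S, a subalgebra of D. *)
Definition Stone_space (S : set D) (algS : is_subalgebra S) :=
  {U : set D | `[< is_ultrafilter S U >]}.

Section Stone_topology.
Variables (S : set D) (algS : is_subalgebra S).
Local Notation K := (Stone_space algS).

HB.instance Definition _ := Choice.on K.

Definition Stone_basic (a : D) : set K := [set x | val x a].

Definition Stone_open (V : set K) : Prop :=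
  forall x, V x -> exists a, [/\ S a, Stone_basic a x & Stone_basic a `<=` V].

Lemma Stone_ultrafilter (x : K) : is_ultrafilter S (val x).
Proof. by apply/asboolP; exact: (valP x). Qed.

Fact Stone_openT : Stone_open setT.
Proof.
move=> x _; exists \top%O; split=> //; first by have [] := algS.
by rewrite /Stone_basic /=; have [_ []] := Stone_ultrafilter x.
Qed.

Fact Stone_openI : setI_closed Stone_open.
Proof.
move=> V W oV oW x [/oV[a [Sa xa aV]] /oW[b [Sb xb bW]]].
exists (a `&` b)%O; split.
- by have [_ _ SI _ _] := algS; exact: SI.
- by have [_ _ UI _ _] := Stone_ultrafilter x; exact: UI.
- move=> y yab; have [_ _ _ Uup _] := Stone_ultrafilter y; split.
  + by apply: aV; apply: Uup yab Sa _; exact: leIl.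
  + by apply: bW; apply: Uup yab Sb _; exact: leIr.
Qed.

Fact Stone_open_bigU (J : Type) (V : J -> set K) :
  (forall i, Stone_open (V i)) -> Stone_open (\bigcup_i V i).
Proof.
move=> oV x [i _ /oV[a [Sa xa aV]]]; exists a; split=> // y /aV Vy.
by exists i.
Qed.

HB.instance Definition _ :=
  isOpenTopological.Build K Stone_openT Stone_openI Stone_open_bigU.

Lemma Stone_compact : compact [set: K].
Proof.
rewrite compact_ultra => F UF _.
pose U : set D := [set a | S a /\ F (Stone_basic a)].
have UU : is_ultrafilter S U.
  have [S0 S1 SI _ SC] := algS; split.
  - by move=> a [].
  - split; first split => //.
      by apply: filterS filterT => x _; have [_ []] := Stone_ultrafilter x.
    move=> [_ F0]; apply: (@filter_not_empty _ F); apply: filterS F0 => x.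
    by rewrite /Stone_basic /=; have [_ []] := Stone_ultrafilter x.
  - move=> a b [Sa Fa] [Sb Fb]; split; first exact: SI.
    apply: filterS2 Fa Fb => x xa xb.
    by have [_ _ UI _ _] := Stone_ultrafilter x; exact: UI.
  - move=> a b [Sa Fa] Sb ab; split=> //; apply: filterS Fa => x xa.
    by have [_ _ _ Uup _] := Stone_ultrafilter x; exact: Uup xa Sb ab.
  - move=> a Sa; have [Fa|Fa] := in_ultra_setVsetC (Stone_basic a) UF.
      by left.
    right; split; first exact: SC.
    apply: filterS Fa => x xa.
    by have [_ _ _ _ /(_ a Sa)[|//]] := Stone_ultrafilter x.
exists (exist _ U (asboolT UU)); split=> //.
move=> V; rewrite nbhsE => -[W [oW Wx] WV].
have [a [_ [_ Fa] aW]] := oW _ Wx.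
by apply: filterS Fa; exact: subset_trans aW WV.
Qed.

End Stone_topology.
End Boolean_algebra.

Section continuous_functions.
Context (R : realType) (K : topologicalType).

Definition continuous_pred : {pred K -> R^o} :=
  [pred f | `[< continuous (f : K -> R) >]].

Fact continuous_submod : submod_closed continuous_pred.
Proof.
split=> [|a f g /asboolP cf /asboolP cg]; apply/asboolP => x.
  exact: cst_continuous.
by apply: cvgD (cg x); apply: cvgM (cf x); exact: cvg_cst.
Qed.

HB.instance Definition _ :=
  GRing.isSubmodClosed.Build R (K -> R^o) continuous_pred continuous_submod.

(* The proof that K is compact is a parameter because the supremum norm is only
   a norm on C(K) when continuous functions are bounded. *)
Definition continuous_functions (cK : compact [set: K]) :=
  {f : K -> R^o | f \in continuous_pred}.

Variable cK : compact [set: K].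
Local Notation CK := (continuous_functions cK).

HB.instance Definition _ := SubChoice.on CK.
HB.instance Definition _ := [SubChoice_isSubLmodule of CK by <:].

Definition sup_norm (f : CK) : R := sup [set `|val f x| | x in [set: K]].

Lemma continuous_val (f : CK) : continuous (val f : K -> R).
Proof. by apply/asboolP; exact: (valP f). Qed.

Lemma sup_norm_ubound (f : CK) :
  has_ubound [set `|val f x| | x in [set: K]].
Proof.
have : compact ((val f : K -> R) @` setT).
  apply: continuous_compact cK; apply: continuous_subspaceT.
  exact: continuous_val.
move=> /compact_bounded[M [_ /(_ (M + 1))]]; rewrite ltrDl ltr01 => /(_ isT) fM.
by exists (M + 1) => _ [x _ <-]; apply: fM; exists x.
Qed.

Lemma sup_norm_ge (f : CK) x : `|val f x| <= sup_norm f.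
Proof. by apply: ub_le_sup; [exact: sup_norm_ubound|exists x]. Qed.

Lemma sup_norm_le (f : CK) (M : R) :
  0 <= M -> (forall x, `|val f x| <= M) -> sup_norm f <= M.
Proof.
move=> M0 fM; have [[x _]|K0] := pselect ([set: K] !=set0).
  apply: ge_sup => [|r [y _ <-]]; last exact: fM.
  by exists `|val f x|; exists x.
rewrite /sup_norm (_ : [set _ | _ in _] = set0) ?sup0//.
by rewrite -subset0 => r [x _ _]; apply: K0; exists x.
Qed.

Lemma sup_norm_ge0 (f : CK) : 0 <= sup_norm f.
Proof.
have [[x _]|K0] := pselect ([set: K] !=set0).
  exact: le_trans (normr_ge0 _) (sup_norm_ge f x).
rewrite /sup_norm (_ : [set _ | _ in _] = set0) ?sup0//.
by rewrite -subset0 => r [x _ _]; apply: K0; exists x.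
Qed.

Fact sup_normD (f g : CK) : sup_norm (f + g) <= sup_norm f + sup_norm g.
Proof.
apply: sup_norm_le => [|x]; first by rewrite addr_ge0 ?sup_norm_ge0.
by apply: le_trans (ler_normD _ _) _; apply: lerD; exact: sup_norm_ge.
Qed.

Fact sup_normZ (a : R) (f : CK) : sup_norm (a *: f) = `|a| * sup_norm f.
Proof.
have leZ (b : R) (g : CK) : sup_norm (b *: g) <= `|b| * sup_norm g.
  apply: sup_norm_le => [|x]; first by rewrite mulr_ge0 ?sup_norm_ge0.
  by rewrite [`|_|]normrM ler_wpM2l// sup_norm_ge.
apply/eqP; rewrite eq_le leZ /=; have [->|a0] := eqVneq a 0.
  by rewrite normr0 mul0r sup_norm_ge0.
rewrite -ler_pdivlMl ?normr_gt0// -normfV.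
by rewrite -[in leLHS](scale1r f) -(mulVf a0) -scalerA leZ.
Qed.

Fact sup_norm0_eq0 (f : CK) : sup_norm f = 0 -> f = 0.
Proof.
move=> f0; apply: val_inj; apply/funext => x; apply/eqP.
by rewrite -normr_le0 -[leRHS]f0; exact: sup_norm_ge.
Qed.

HB.instance Definition _ :=
  @Lmodule_isNormed.Build R CK sup_norm sup_normD sup_normZ sup_norm0_eq0.

Definition clopen_indicators : set CK :=
  [set f | exists2 A : set K, clopen A & val f = \1_A].

End continuous_functions.
Arguments continuous_functions R {K} cK.

Definition linear_span (R : realType) (V : lmodType R) (G : set V) : set V :=
  [set v | exists (n : nat) (r : 'I_n -> R) (g : 'I_n -> V),
    (forall i, G (g i)) /\ v = \sum_(i < n) r i *: g i].

Section weak_topology.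
Context (R : realType) (V : normedModType R).

Definition dual_space := {phi : {linear V -> R^o} | `[< continuous phi >]}.

Definition dual_pairing (v : V) : {ptws dual_space -> R^o} :=
  fun phi => val phi v.

Definition weakly_topologized : topologicalType :=
  initial_topology dual_pairing.

Definition weak_Baire : set (set V) :=
  Baire_sigma_algebra R weakly_topologized.

End weak_topology.
Arguments weak_Baire {R} V.

Section setting.
Context (R : realType) (I : Type) (lambda : probability (Baire_cube R I) R).

Definition cube_algebra : ctbDistrLatticeType measure_algebra_display :=
  measure_algebra lambda.

Definition nonzero_cube_algebra := {b : cube_algebra | b != \bot%O}.

Variable N : nonzero_cube_algebra -> set nat.

(* The element G_b of the power algebra. *)
Definition N_generator (b : nonzero_cube_algebra) :
    power_algebra cube_algebra :=
  fun n => if n \in N b then val b else \bot%O.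

Definition N_algebra : set (power_algebra cube_algebra) :=
  generated_subalgebra (range N_generator).

Lemma N_algebraP : is_subalgebra N_algebra.
Proof. exact: generated_subalgebraP. Qed.

Definition N_Stone : topologicalType := Stone_space N_algebraP.

Definition N_C : normedModType R :=
  continuous_functions R (@Stone_compact _ _ _ N_algebraP).

(* The space S(K), as a subset of C(K). *)
Definition N_S : set N_C := linear_span (@clopen_indicators R N_Stone _).

End setting.
Arguments N_generator {R I lambda} N b.
Arguments N_algebra {R I lambda} N.
Arguments N_Stone {R I lambda} N.
Arguments N_C {R I lambda} N.
Arguments N_S {R I lambda} N.

(* Main.v *)
From HB Require Import structures.
Require Import Defs.
From mathcomp Require Import all_boot all_order all_algebra finmap.
From mathcomp Require Import all_classical all_reals all_analysis.
From mathcomp Require Import measurable_realfun ring lra.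
Import Order.Theory GRing.Theory Num.Theory.
Import numFieldNormedType.Exports.
Local Open Scope classical_set_scope.
Local Open Scope ring_scope.
Set Implicit Arguments.
Unset Strict Implicit.
Unset Printing Implicit Defensive.

(** Write J for the set of nonzero elements of the measure algebra D, m for the
    measure on D, and G_s for the meet of the generators G_b, b in the finite
    set s. Every f in S(K) is a polynomial: a finite sum of terms r_i times the
    indicator of G_(s_i).

    Functionals. For each X, a subset of J, independence of the N_b gives an
    ultrafilter on the integers that contains N_b for b in X and the complement
    of N_b for the other b. The limit, along this ultrafilter, of the values at
    n of the measure m is a state phi_X on the algebra A: phi_X(G_s) is the
    measure of the meet of s if s is included in X, and 0 otherwise. Each phi_X
    extends to a functional of norm at most 1 on C(K); it is obtained directly
    as an ultrafilter limit of Riemann sums ([tail_integral]).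

    On S(K) the family (phi_X) separates points ([tail_integral_separates]):
    evaluate at X = s for s of minimal cardinality among the monomials of f.
    The meet of s has positive measure unless G_s = 0, so the coefficient of a
    nonzero G_s vanishes as soon as all the phi_X(f) do.

    The support of f. For f in S(K), phi_X(f) depends only on the trace of X on
    some finite set, and there is a least such finite set T(f) ([support]). The
    set J injects into the reals because a class modulo null sets is determined
    by approximations by clopen sets ([small_cube_algebra]). Hence there is a
    countable family Q of subsets of J that induces every subset of every
    finite subset of J, and T(f) is included in A iff phi_X(f) equals
    phi_(X meet A)(f) for all X in Q. So each event that T(f) is included in A
    is measurable, for every A included in J, however wild.

    The Kunen property upgrades this: a map into the finite subsets of J for
    which all these events are measurable has all its fibres over arbitrary
    families of finite sets measurable ([hit_discretely_measurable]). Cut the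
    finite set by the members of Q into pieces of at most one point; each piece
    is measurable for the full power set, and so is a union of two such pieces,
    because every set of pairs lies in the product sigma-algebra.

    The norm. For a finite set T, the f with T(f) included in T form a space W_T
    on which finitely many phi_X, X in Q, separate points, so these span its
    dual. By rational approximation the norm of f exceeds t iff some rational
    combination psi of the phi_X, X in Q, has |psi(f)| > t and norm at most 1
    on W_(T(f)). There are countably many psi, the first condition is
    measurable, and the second is a condition on T(f) alone, hence measurable
    ([measurable_norm_gt]). *)

(** * Sets of cardinality at most the continuum *)

(** Cardinality at most the continuum. Sequences of bits are used instead of real
    numbers because products, sequences and families coded by a countable set
    then need only a reindexing of bits. *)
Definition small (T : Type) : Prop :=
  exists f : T -> nat -> bool, injective f.

Lemma small_inj (T U : Type) (f : T -> U) : injective f -> small U -> small T.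
Proof. by move=> fI [g gI]; exists (g \o f); exact: inj_comp. Qed.

Lemma small_countType (C : countType) (T : Type) (f : T -> C -> bool) :
  injective f -> small T.
Proof.
move=> fI; exists (fun t n => oapp (f t) false (choice.unpickle n)).
move=> s t st; apply: fI; apply/funext => c.
by have := congr1 (fun u => u (choice.pickle c)) st; rewrite /= choice.pickleK.
Qed.

Lemma small_fun (C : countType) (T : Type) : small T -> small (C -> T).
Proof.
move=> [f fI]; apply: (@small_countType (C * nat)%type _
  (fun h p => f (h p.1) p.2)) => g h gh.
apply/funext => c; apply: fI; apply/funext => n.
exact: (congr1 (fun u => u (c, n)) gh).
Qed.

Lemma small_prod (T U : Type) : small T -> small U -> small (T * U)%type.
Proof.
move=> [f fI] [g gI]; apply: (@small_countType (nat + nat)%type _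
  (fun p s => match s with inl n => f p.1 n | inr n => g p.2 n end)).
move=> [a b] [c d] /= e; congr pair.
  by apply: fI; apply/funext => n; exact: (congr1 (fun u => u (inl n)) e).
by apply: gI; apply/funext => n; exact: (congr1 (fun u => u (inr n)) e).
Qed.

Lemma small_seq (T : Type) : small T -> small (seq T).
Proof.
move=> [f fI]; apply: (@small_countType (nat * option nat)%type _
  (fun s p => if p.2 is Some c then nth false (map (f^~ c) s) p.1
              else p.1 < size s)%N) => s t st.
have sz : size s = size t.
  have lt_s : forall n, (n < size s)%N = (n < size t)%N.
    by move=> n; exact: (congr1 (fun u => u (n, None)) st).
  case: (ltngtP (size s) (size t)) => // ts.
    by move: ts; rewrite -lt_s ltnn.
  by move: ts; rewrite lt_s ltnn.
have {}st n c := congr1 (fun u => u (n, Some c)) st.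
elim: s t sz st => [[]//|a s IH [//|b t]] /= [sz] st; congr cons.
  by apply: fI; apply/funext => c; exact: (st 0%N).
by apply: IH => // n c; exact: (st n.+1).
Qed.

Lemma small_fset (T : choiceType) : small T -> small {fset T}.
Proof.
move=> /small_seq; apply: (@small_inj _ _ (@enum_fset T)) => X Y XY.
by apply/fsetP => z; rewrite -[z \in X]/(z \in enum_fset X) XY.
Qed.

(** A real number is determined by the rationals below it. *)
Lemma small_real (R : realType) : small R.
Proof.
apply: (@small_countType rat _ (fun r q => ratr q < r)) => r s rs.
wlog lt_rs : r s rs / r < s.
  by move=> H; case: (ltgtP r s) => // /H; [exact|move=> /(_ (esym rs))].
have [q] := rat_in_itvoo lt_rs; rewrite in_itv/= => /andP[rq qs].
by have := congr1 (fun u => u q) rs; rewrite /= qs ltNge (ltW rq).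
Qed.

Section cantor_set.
Variable R : realType.

Let p (x : nat -> bool) n : R := \sum_(i < n) (x i)%:R * 3^-1 ^+ i.

Let p_ub x k m : p x (k + m) <= p x k + 3 / 2 * 3^-1 ^+ k * (1 - 3^-1 ^+ m).
Proof.
elim: m => [|m IH]; first by rewrite addn0 expr0 subrr mulr0 addr0.
rewrite addnS {1}/p big_ord_recr /= -/(p x (k + m)%N).
have x1 : (x (k + m)%N)%:R <= 1 :> R by case: (x _).
have : 0 <= (3^-1 : R) ^+ k * 3^-1 ^+ m by rewrite mulr_ge0// exprn_ge0.
rewrite exprD [_ ^+ m.+1]exprS; move: IH x1.
move: (3^-1 ^+ k) (3^-1 ^+ m) ((x (k + m)%N)%:R) (p x (k + m)%N) (p x k).
move=> u v z P Q H z1 uv.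
have : z * (u * v) <= u * v by rewrite ler_piMl.
nra.
Qed.

Let p_le x k n : p x n <= p x k + 3 / 2 * 3^-1 ^+ k.
Proof.
have p0 : 0 <= (3^-1 : R) ^+ k by rewrite exprn_ge0.
have [/subnKC <-|/ltnW nk] := leqP k n.
  apply: le_trans (p_ub _ _ _) _.
  have : 0 <= (3^-1 : R) ^+ (n - k) by rewrite exprn_ge0.
  nra.
apply: (@le_trans _ _ (p x k)); last by nra.
rewrite -(subnKC nk); elim: (k - n)%N => [|m IH]; first by rewrite addn0.
by rewrite addnS {2}/p big_ord_recr /= -/(p x _) ler_wpDr// mulr_ge0// exprn_ge0.
Qed.

(** Read the bits as digits in base 3: after the first difference, in place k, all
    later digits together contribute at most half of the unit of place k, so the
    order of the two sums is decided there. *)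
Lemma inj_cantor_real : exists f : (nat -> bool) -> R, injective f.
Proof.
exists (fun x => sup (range (p x))) => x y xy.
suff key (a b : nat -> bool) k : (forall i, (i < k)%N -> a i = b i) -> a k ->
    ~~ b k -> sup (range (p b)) < sup (range (p a)).
  apply: contrapT => /eqP; rewrite -[_ == _]/(x == y) => /eqP nxy.
  have ex : exists k, x k != y k.
    apply: contrapT => /forallNP h; apply: nxy; apply/funext => k.
    by apply/eqP; apply: contrapT => /negP /(h k).
  have := ex_minnP ex => -[k xyk kmin].
  have eqb i : (i < k)%N -> x i = y i.
    move=> ik; apply/eqP; apply: contraTT ik => /kmin.
    by rewrite -leqNgt.
  case xk : (x k) xyk; case yk : (y k) => // _.
    by have := key x y k eqb xk (negbT yk); rewrite xy ltxx.
  by have := key y x k (fun i ik => esym (eqb i ik)) yk (negbT xk);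
    rewrite xy ltxx.
move=> ab ak bk.
have k0 : 0 < (3^-1 : R) ^+ k by rewrite exprn_gt0.
have pab : p a k = p b k by apply: eq_bigr => i _; rewrite ab.
apply: (@le_lt_trans _ _ (p b k.+1 + 3 / 2 * 3^-1 ^+ k.+1)).
  by apply: ge_sup => [|_ [n _ <-]]; [exists (p b 0), 0%N|exact: p_le].
apply: (@lt_le_trans _ _ (p a k.+1)); last first.
  apply: ub_le_sup; last by exists k.+1.
  by exists (p a 0 + 3 / 2 * 3^-1 ^+ 0) => _ [n _ <-]; exact: p_le.
have pS x' : p x' k.+1 = p x' k + (x' k)%:R * 3^-1 ^+ k by rewrite /p big_ord_recr.
rewrite !pS pab ak (negbTE bk) [_ ^+ k.+1]exprS /=; lra.
Qed.

End cantor_set.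

(** The property goes down along an injection h: push a set of pairs forward by
    h x h, and pull the rectangles of the larger square back. *)
Lemma Kunen_small (R : realType) (T : Type) :
  Kunen_cardinal R -> small T -> Kunen_cardinal T.
Proof.
move=> KR [f fI]; have [g gI] := inj_cantor_real R.
pose h := g \o f; have hI : injective h by exact: inj_comp.
apply/seteqP; split=> // E _.
pose E' : set (R * R) := [set (h p.1, h p.2) | p in E].
pose Q : set (set (R * R)) := [set W |
  (<<s [set A `*` B | A in [set: set T] & B in [set: set T]] >>)
    [set p | W (h p.1, h p.2)]].
have sQ : sigma_algebra setT Q.
  have [S0 SD SU] := smallest_sigma_algebra setT
    [set A `*` B | A in [set: set T] & B in [set: set T]].
  split; first exact: S0.
    by move=> A QA; have := SD _ QA; congr (<<s _ >> _); apply/seteqP; split.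
  by move=> F QF; have := SU _ QF; congr (<<s _ >> _); apply/seteqP; split.
have sub : <<s [set A `*` B | A in [set: set R] & B in [set: set R]] >> `<=` Q.
  apply: smallest_sub => // _ [A _ [B _ <-]].
  by apply: sub_sigma_algebra; exists (h @^-1` A) => //; exists (h @^-1` B).
have : Q E' by apply: sub; rewrite KR.
rewrite /Q /=; congr (<<s _ >> _); apply/seteqP; split.
  by move=> [a b] /= [[c d] Ecd /= [/hI <- /hI <-]].
by move=> [a b] Eab; exists (a, b).
Qed.

(** * Finite-set-valued maps over a Kunen cardinal *)

Section discrete.
Context d (Om : measurableType d).

Definition discretely_measurable (X : Type) (g : Om -> X) : Prop :=
  forall E : set X, measurable (g @^-1` E).

(** This is where the Kunen property acts: any set of pairs is generated by
    rectangles, whose preimages are intersections of two measurable sets. *)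
Lemma discretely_measurable_pair (X : Type) (g h : Om -> X) :
  Kunen_cardinal X -> discretely_measurable g -> discretely_measurable h ->
  discretely_measurable (fun w => (g w, h w)).
Proof.
move=> KX gm hm E.
pose Q : set (set (X * X)) := [set W |
  measurable ((fun w => (g w, h w)) @^-1` W)].
suff : <<s [set A `*` B | A in [set: set X] & B in [set: set X]] >> `<=` Q.
  by apply; rewrite KX.
apply: smallest_sub => [|_ [A _ [B _ <-]]].
  split; rewrite /Q /=.
  - by rewrite preimage_set0.
  - by move=> A mA; rewrite setTD preimage_setC; exact: measurableC.
  - by move=> F mF; rewrite preimage_bigcup; exact: bigcupT_measurable.
exact: (measurableI _ _ (gm A) (hm B)).
Qed.

Variables (J : choiceType) (code : J -> nat -> bool).
Hypotheses (codeI : injective code) (KJ : Kunen_cardinal {fset J}).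

(** A priori much weaker than measurability for the full power set of the finite
    subsets of J: only the families of subsets of a fixed A are tested. *)
Definition hit_measurable (T : Om -> {fset J}) : Prop :=
  forall A : set J, measurable [set w | [set` T w] `<=` A].

Definition fset_restr (X : {fset J}) (A : set J) : {fset J} :=
  [fset x in X | x \in A]%fset.

Lemma fset_restrE X A : [set` fset_restr X A] = [set` X] `&` A.
Proof.
apply/seteqP; split=> x /=; rewrite !inE /=.
  by move=> /andP[-> /set_mem].
by move=> [-> /mem_set].
Qed.

Lemma hit_measurable_restr T A :
  hit_measurable T -> hit_measurable (fun w => fset_restr (T w) A).
Proof.
move=> mT B; rewrite (_ : [set w | _] = [set w | [set` T w] `<=` B `|` ~` A]).
  exact: mT.
apply/seteqP; split=> w /=; rewrite fset_restrE => H j.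
  by move=> Tj; have [Aj|] := pselect (A j); [left; exact: H|right].
by move=> [/H[]].
Qed.

Definition subsingleton (X : {fset J}) : Prop :=
  forall i j, i \in X -> j \in X -> i = j.

Definition sole (X : {fset J}) : {fset J} :=
  if `[< subsingleton X >] then X else fset0.

(** The bits of the code separate points, so countably many conditions on
    inclusions recognize the sets with at most one point. *)
Lemma subsingleton_code (X : {fset J}) : subsingleton X <->
  forall n, [set` X] `<=` [set j | code j n] \/ [set` X] `<=` ~` [set j | code j n].
Proof.
split=> [X1 n|H i j iX jX].
  have [[j Xj jn]|nX] := pselect (exists2 j, j \in X & code j n); [left|right].
    by move=> i /= Xi; rewrite (X1 _ _ Xi Xj).
  by move=> j /= Xj jn; apply: nX; exists j.
apply: codeI; apply/funext => n; have [h|h] := H n.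
  by rewrite (h _ iX) (h _ jX).
by move: (h _ iX) (h _ jX) => /= /negP/negbTE -> /negP/negbTE ->.
Qed.

Lemma subsingleton_eq1 (X : {fset J}) j :
  subsingleton X -> j \in X -> X = [fset j]%fset.
Proof.
move=> X1 jX; apply/fsetP => i; rewrite inE.
by apply/idP/eqP => [iX|->//]; exact: X1.
Qed.

(** A singleton belongs to a family E iff it is included in the set of the points
    whose singleton is in E; this is an inclusion condition. *)
Lemma discretely_measurable_sole T :
  hit_measurable T -> discretely_measurable (fun w => sole (T w)).
Proof.
move=> mT E.
have m1 : measurable [set w | subsingleton (T w)].
  rewrite (_ : [set w | _] = \bigcap_n
    ([set w | [set` T w] `<=` [set j | code j n]] `|`
     [set w | [set` T w] `<=` ~` [set j | code j n]])).
    by apply: bigcapT_measurable => n; apply: measurableU; exact: mT.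
  apply/seteqP; split=> w /=; first by move=> /subsingleton_code H n _; exact: H.
  by move=> H; apply/subsingleton_code => n; exact: (H n).
(* The value fset0 of [sole] is ambiguous: it comes from an empty set or from one
   with several points. *)
rewrite (_ : _ @^-1` E =
  (([set w | [set` T w] `<=` set0] `|` ~` [set w | subsingleton (T w)]) `&`
    [set _ | E fset0]) `|`
  ([set w | subsingleton (T w)] `&` ~` [set w | [set` T w] `<=` set0] `&`
   [set w | [set` T w] `<=` [set j | E [fset j]%fset]])).
  apply: measurableU; apply: measurableI.
  - by apply: measurableU; [exact: mT|exact: measurableC].
  - by have [E0|E0] := pselect (E fset0);
      [rewrite (_ : [set _ | _] = setT)|rewrite (_ : [set _ | _] = set0)] => //;
      apply/seteqP; split.
  - by apply: measurableI => //; apply: measurableC; exact: mT.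
  - exact: mT.
have T0 w : [set` T w] `<=` set0 <-> T w = fset0.
  split=> [H|->]; last by move=> j; rewrite /= inE.
  by apply/fsetP => j; rewrite inE; apply/negP => /H.
apply/seteqP; split=> w /=; rewrite T0 /sole.
  case: asboolP => [T1 ET|T1 E0]; last by left; split=> //; right.
  have [E0|E0] := pselect (T w = fset0); [left|right].
    by rewrite -E0; split=> //; left.
  by split=> // j Tj /=; rewrite -(subsingleton_eq1 T1 Tj).
case: asboolP => T1; last by case=> [[]//|[[]]].
case=> [[[->|//]//]|[[_ /eqP/fset0Pn[j Tj]] /(_ _ Tj) /=]].
by rewrite -(subsingleton_eq1 T1 Tj).
Qed.

(** The part of X that the first n bits of the code resolve: cut X into cells by
    these bits and keep the cells with a single point. A finite X is recovered
    once n is large. *)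
Fixpoint code_approx (n : nat) (X : {fset J}) : {fset J} :=
  if n is n'.+1 then
    (code_approx n' (fset_restr X [set j | code j n']) `|`
     code_approx n' (fset_restr X (~` [set j | code j n'])))%fset
  else sole X.

Lemma discretely_measurable_approx n T :
  hit_measurable T -> discretely_measurable (fun w => code_approx n (T w)).
Proof.
elim: n T => [|n IH] T mT; first exact: discretely_measurable_sole.
move=> E /=.
have [m1 m2] := (IH _ (@hit_measurable_restr _ [set j | code j n] mT),
  IH _ (@hit_measurable_restr _ (~` [set j | code j n]) mT)).
exact: (discretely_measurable_pair KJ m1 m2
  [set p : {fset J} * {fset J} | E (p.1 `|` p.2)%fset]).
Qed.

Lemma code_approxE n (X : {fset J}) :
  (forall i j, i \in X -> j \in X -> i != j ->
    exists2 k, (k < n)%N & code i k != code j k) -> code_approx n X = X.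
Proof.
elim: n X => [|n IH] X sepX /=.
  rewrite /sole; case: asboolP => // -[] i j iX jX.
  by apply/eqP/negPn/negP => /(sepX _ _ iX jX)[].
have sepR A : (forall i j, A i -> A j -> code i n = code j n) ->
    forall i j, i \in fset_restr X A -> j \in fset_restr X A -> i != j ->
    exists2 k, (k < n)%N & code i k != code j k.
  move=> An i j; rewrite !inE /= => /andP[iX /set_mem Ai] /andP[jX /set_mem Aj] ij.
  have [k] := sepX _ _ iX jX ij; rewrite ltnS leq_eqVlt => /predU1P[->|kn kc].
    by rewrite (An i j)// eqxx.
  by exists k.
rewrite !IH.
- apply/fsetP => j; rewrite !inE /= -andb_orr.
  case: (j \in X) => //=; apply/orP.
  by case: (pselect (code j n)) => h; [left|right]; exact/mem_set.
- by apply: sepR => i j /= /negP/negbTE -> /negP/negbTE ->.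
- by apply: sepR => i j /= -> ->.
Qed.

(** Take one separating bit for each of the finitely many pairs of points of X. *)
Lemma code_separates (X : {fset J}) : exists n0, forall n, (n0 <= n)%N ->
  forall i j, i \in X -> j \in X -> i != j ->
    exists2 k, (k < n)%N & code i k != code j k.
Proof.
pose sep i j := xget 0%N [set k | code i k != code j k].
have sepP i j : i != j -> code i (sep i j) != code j (sep i j).
  move=> ij; rewrite /sep; case: xgetP => [k _//|H].
  case/eqP: ij; apply: codeI; apply/funext => k; apply/eqP/negPn/negP.
  exact: (H k).
exists (\max_(p <- [seq (i, j) | i <- X, j <- X]) (sep p.1 p.2).+1)%N.
move=> n hn i j iX jX ij; exists (sep i j); last exact: sepP.
apply: leq_trans hn.
apply: (@leq_bigmax_seq _ _ xpredT (fun p => (sep p.1 p.2).+1) (i, j)) => //.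
by apply/allpairsP; exists (i, j).
Qed.

(** T is the pointwise eventually constant limit of its approximations, and these
    are finite unions of pieces that are measurable for the full power set. *)
Lemma hit_discretely_measurable T :
  hit_measurable T -> discretely_measurable T.
Proof.
move=> mT E; rewrite (_ : T @^-1` E = \bigcup_m \bigcap_n
    [set w | E (code_approx (m + n) (T w))]); last first.
  apply/seteqP; split=> w /=.
    have [m Hm] := code_separates (T w) => ET; exists m => // n _ /=.
    by rewrite code_approxE//; exact: Hm (leq_addr _ _).
  move=> [m _ H]; have [m' Hm] := code_separates (T w).
  have /= := H m' I; rewrite code_approxE//; exact: Hm (leq_addl _ _).
apply: bigcupT_measurable => m; apply: bigcapT_measurable => n.
exact: discretely_measurable_approx.
Qed.

End discrete.

(** * Measurability of a norm from countably many functionals *)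

Lemma measurable_bigcap_countType d (Om : measurableType d) (C : countType)
    (F : C -> set Om) :
  (forall c, measurable (F c)) -> measurable (\bigcap_c F c).
Proof.
move=> mF; rewrite (_ : \bigcap_c F c =
    \bigcap_n oapp F setT (choice.unpickle n : option C)).
  by apply: bigcapT_measurable => n; case: choice.unpickle => [c|];
    [exact: mF|exact: measurableT].
apply/seteqP; split=> w H.
  by move=> n _; case: choice.unpickle => [c|//]; exact: H.
by move=> c _; have := H (choice.pickle c) I; rewrite choice.pickleK.
Qed.

Lemma measurable_bigcup_countType d (Om : measurableType d) (C : countType)
    (F : C -> set Om) :
  (forall c, measurable (F c)) -> measurable (\bigcup_c F c).
Proof.
move=> mF; rewrite -[X in measurable X]setCK setC_bigcup; apply: measurableC.
by apply: measurable_bigcap_countType => c; exact: measurableC.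
Qed.

Section functionals.
Context (R : realType) (V : normedModType R) (C : eqType).
Variable psi : C -> {linear V -> R^o}.

Definition combination (p : seq (R * C)) (g : V) : R :=
  \sum_(q <- p) q.1 * psi q.2 g.

(** A functional that vanishes where finitely many given ones vanish is a linear
    combination of them. Induction on their number: restrict to the kernel of the
    first one, and correct along a vector on which it does not vanish. The
    statement is relative to a subspace W because the values outside W are not
    controlled. *)
Lemma linear_combination_of_kernels (l : seq C) (W : set V)
    (delta : {linear V -> R^o}) :
  (forall a f g, W f -> W g -> W (a *: f + g)) ->
  (forall g, W g -> (forall c, c \in l -> psi c g = 0) -> delta g = 0) ->
  exists p, forall g, W g -> delta g = combination p g.
Proof.
elim: l W => [|c l IH] W Wlin Wker.
  by exists [::] => g Wg; rewrite /combination big_nil; exact: Wker.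
pose W0 := W `&` [set g | psi c g = 0].
have [|g [Wg cg] lg|p Hp] := IH W0.
- move=> a f g [Wf cf] [Wg cg]; split; first exact: Wlin.
  by rewrite /= linearP cf cg scaler0 addr0.
- by apply: Wker => // c'; rewrite inE => /predU1P[->|/lg].
have [[w Ww cw]|W_ker_c] := pselect (exists2 w, W w & psi c w != 0); last first.
  exists p => g Wg; apply: Hp; split=> //=.
  by apply/eqP/negPn/negP => cg; apply: W_ker_c; exists g.
exists ((((delta w - combination p w) / psi c w : R), c) :: p) => g Wg.
pose a : R := psi c g / psi c w.
have W0g : W0 (- a *: w + g).
  split; first exact: Wlin.
  by rewrite /= linearP /a scaleNr /= -[_ *: _]/(_ * _) divfK// addNr.
have combP b f h : combination p (b *: f + h) = b * combination p f + combination p h.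
  rewrite /combination mulr_sumr -big_split /=; apply: eq_bigr => q _.
  by rewrite linearP mulrDr mulrCA.
have := Hp _ W0g; rewrite linearP combP /= -[_ *: delta w]/(_ * _).
rewrite /combination big_cons /= -/(combination p g) -/(combination p w) /a.
move/eqP; rewrite -subr_eq0 => /eqP H; apply/eqP.
by rewrite -subr_eq0 -H; apply/eqP; ring.
Qed.

Hypothesis psi_le : forall c g, `|psi c g : R| <= `|g|.

Lemma rational_combination (p : seq (R * C)) (eta : R) : 0 < eta ->
  exists q : seq (rat * C), forall g,
    `|combination [seq (ratr x.1, x.2) | x <- q] g - combination p g|
      <= eta * `|g|.
Proof.
elim: p eta => [|[r c] p IH] eta eta0.
  by exists [::] => g; rewrite /combination !big_nil subrr normr0 mulr_ge0// ltW.
have [q Hq] := IH (eta / 2) (divr_gt0 eta0 (ltr0Sn _ _)).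
have /rat_in_itvoo[s] : r < r + eta / 2 by rewrite ltrDl divr_gt0.
rewrite in_itv /= => /andP[rs sr]; exists ((s, c) :: q) => g.
rewrite /combination !big_cons /= -/(combination p g).
rewrite -/(combination [seq (ratr x.1, x.2) | x <- q] g).
have -> (a b x y : R) : a + b - (x + y) = (a - x) + (b - y) by ring.
rewrite (le_trans (ler_normD _ _))// [eta](splitr eta) mulrDl lerD//.
rewrite -mulrBl normrM ler_pM// ger0_norm; lra.
Qed.

End functionals.

Section norm_measurability.
Context (R : realType) (V : normedModType R) (J : choiceType).
Variables (code : J -> nat -> bool) (S : set V).
Variable phi : set J -> {linear V -> R^o}.
Hypotheses (codeI : injective code) (KJ : Kunen_cardinal {fset J}).
Hypothesis S_lin : forall a f g, S f -> S g -> S (a *: f + g).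
Hypothesis phi_le : forall X g, `|phi X g : R| <= `|g|.
Hypothesis phi_finite : forall f, S f ->
  exists T : {fset J}, forall X, phi X f = phi (X `&` [set` T]) f.
Hypothesis phi_inj : forall f, S f -> (forall X, phi X f = 0) -> f = 0.
Hypothesis S_norming : forall f (t : R), S f -> 0 <= t -> t < `|f| ->
  exists2 delta : {linear V -> R^o},
    (forall g, `|delta g : R| <= `|g|) & t < `|delta f : R|.

(** The sets that are a finite union of cylinders of the code. They form the
    countable family of subsets of J that is used to test functionals. *)
Definition code_cell (l : seq (seq bool)) : set J :=
  [set j | has (fun w => mkseq (code j) (size w) == w) l].

Lemma code_cell_trace (T : {fset J}) (A : set J) :
  exists l, code_cell l `&` [set` T] = A `&` [set` T].
Proof.
have [n /(_ _ (leqnn _)) sepT] := code_separates codeI T.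
exists [seq mkseq (code j) n | j <- fset_restr T A].
apply/seteqP; split=> j [cj Tj]; split=> //.
  move: cj; rewrite /code_cell /= has_map => /hasP[i]; rewrite !inE /= size_mkseq.
  move=> /andP[Ti /set_mem Ai] /eqP ij.
  suff -> : j = i by [].
  apply/eqP/negPn/negP => /(sepT _ _ Tj Ti)[k kn /negP]; apply.
  by rewrite -(nth_mkseq false (code j) kn) ij nth_mkseq.
rewrite /code_cell /= has_map; apply/hasP; exists j.
  by rewrite !inE /=; apply/andP; split=> //; exact/mem_set.
by rewrite /= size_mkseq.
Qed.

(** A carries f, as far as the functionals phi_X can tell. *)
Definition lives_on (f : V) (A : set J) : Prop :=
  forall X, phi X f = phi (X `&` A) f.

Lemma lives_onI f A B : lives_on f A -> lives_on f B -> lives_on f (A `&` B).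
Proof. by move=> fA fB X; rewrite fA fB setIA. Qed.

Lemma lives_on_lin a f g A :
  lives_on f A -> lives_on g A -> lives_on (a *: f + g) A.
Proof. by move=> fA gA X; rewrite !linearP /= fA gA. Qed.

(** By [phi_finite] only the trace of X on a finite set matters, and every such
    trace is the trace of a cell. *)
Lemma lives_on_cells f A : S f ->
  (forall l, phi (code_cell l) f = phi (code_cell l `&` A) f) -> lives_on f A.
Proof.
move=> /phi_finite[T fT] fA X; have [l lX] := code_cell_trace T X.
by rewrite fT -lX -fT fA fT setIAC lX setIAC -fT.
Qed.

(** The carriers of f are stable under intersection and one of them is finite, so
    a finite carrier of minimal cardinality is the least carrier. *)
Lemma support_exists f : S f ->
  exists T : {fset J}, forall A, lives_on f A <-> [set` T] `<=` A.
Proof.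
move=> Sf; pose P n := `[< exists2 T : {fset J}, #|` T| = n & lives_on f [set` T] >].
have exP : exists n, P n.
  by have [T fT] := phi_finite Sf; exists #|` T|; apply/asboolP; exists T.
have [n /asboolP[T Tn fT] nmin] := ex_minnP exP.
exists T => A; split=> [fA|TA]; last first.
  by move=> X; rewrite fT [RHS]fT -setIA; congr (phi (_ `&` _) f); exact/esym/setIidr.
have TA : fset_restr T A = T.
  apply/eqP; rewrite eqEfcard; apply/andP; split.
    by apply/fsubsetP => j; rewrite !inE => /andP[].
  rewrite Tn; apply: nmin; apply/asboolP; exists (fset_restr T A) => //.
  by rewrite fset_restrE; exact: lives_onI.
by rewrite -TA fset_restrE.
Qed.

Definition support (f : V) : {fset J} :=
  xget fset0 [set T : {fset J} | S f /\ forall A, lives_on f A <-> [set` T] `<=` A].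

Lemma supportP f A : S f -> (lives_on f A <-> [set` support f] `<=` A).
Proof.
move=> Sf; rewrite /support; case: xgetP => [T _ [_ H]|H]; first exact: H.
by have [T HT] := support_exists Sf; have := H T; case.
Qed.

Lemma supportN f : ~ S f -> support f = fset0.
Proof. by move=> nSf; rewrite /support; case: xgetP => // T _ []. Qed.

Let psi l := phi (code_cell l).

(** A functional that nearly attains the norm of f is, on the elements with the
    same support as f, a real combination of the functionals of finitely many
    cells. It is first shrunk by 1 - eta, which leaves room for a rational
    approximation of its coefficients within eta while the norm stays at most 1. *)
Lemma norming_combination f (t : R) : S f -> 0 <= t -> t < `|f| ->
  exists q : seq (rat * seq (seq bool)),
    t < `|combination psi [seq (ratr x.1, x.2) | x <- q] f| /\
    forall g, S g -> lives_on g [set` support f] ->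
      `|combination psi [seq (ratr x.1, x.2) | x <- q] g| <= `|g|.
Proof.
move=> Sf t0 tf; have [delta delta_le tdelta] := S_norming Sf t0 tf.
pose T := support f.
pose W := S `&` [set g | lives_on g [set` T]].
have Wf : W f by split=> //; exact/supportP.
have [cell cellP] := boolp.choice (fun Y : {fset J} => code_cell_trace T [set` Y]).
have [p Hp] : exists p, forall g, W g -> delta g = combination psi p g.
  apply: (@linear_combination_of_kernels _ _ _ psi (map cell (enum_fset (fpowerset T)))).
    move=> a g h [Sg Tg] [Sh Th]; split; first exact: S_lin.
    exact: lives_on_lin.
  move=> g [Sg gT] g0; rewrite (_ : g = 0) ?linear0//.
  apply: phi_inj => // X.
  have := g0 (cell (fset_restr T X)); rewrite /psi gT cellP fset_restrE.
  rewrite setIAC setIid setIC -gT; apply; apply/map_f.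
  by rewrite fpowersetE; apply/fsubsetP => j; rewrite !inE => /andP[].
pose D : R := `|delta f : R|.
have D0 : 0 <= D by exact: normr_ge0.
have f0 : 0 <= `|f| by exact: normr_ge0.
(* This eta makes (1 - eta) D - eta |f| larger than t. *)
pose eta := (D - t) / (D + `|f| + 1).
have eta0 : 0 < eta by rewrite divr_gt0 ?subr_gt0//; lra.
have eta1 : eta * (D + `|f| + 1) = D - t by rewrite divfK//; apply/lt0r_neq0; lra.
have etaD : eta < 1 by nra.
have [q Hq] := rational_combination (fun l => phi_le (code_cell l))
  [seq ((1 - eta) * x.1, x.2) | x <- p] eta0.
have combZ g : combination psi [seq ((1 - eta) * x.1, x.2) | x <- p] g =
    (1 - eta) * combination psi p g.
  by rewrite /combination big_map mulr_sumr; apply: eq_bigr => x _; rewrite mulrA.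
have {}Hq g : W g -> `|combination psi [seq (ratr x.1, x.2) | x <- q] g
    - (1 - eta) * delta g| <= eta * `|g|.
  by move=> Wg; rewrite (Hp _ Wg) -combZ; exact: Hq.
exists q; split=> [|g Sg gT].
  have := Hq f Wf; set c := combination _ _ _ => Hc.
  have : (1 - eta) * D <= `|c| + eta * `|f|.
    rewrite /D -[X in X * _]ger0_norm; last lra.
    rewrite -normrM -lerBlDl (le_trans _ Hc)// distrC.
    exact: lerB_dist.
  nra.
have Wg : W g by [].
have := Hq g Wg; set c := combination _ _ _ => Hc.
have := delta_le g => dg.
have h1 : `|c| <= eta * `|g| + `|(1 - eta) * delta g|.
  by rewrite -lerBlDr (le_trans _ Hc)// lerB_dist.
have h2 : `|(1 - eta) * delta g| <= (1 - eta) * `|g|.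
  by rewrite normrM ger0_norm ?ler_pM2l//; lra.
lra.
Qed.

Context d (Om : measurableType d) (v : Om -> V).
Hypothesis mS : measurable (v @^-1` S).
Hypothesis mphi : forall X, measurable_fun setT (fun w => phi X (v w) : R).

(** Inclusion of the support in A is tested by countably many equalities between
    measurable functions, one for each cell. *)
Lemma support_hit_measurable : hit_measurable (fun w => support (v w)).
Proof.
move=> A; rewrite (_ : [set w | _] = ~` (v @^-1` S) `|` (v @^-1` S `&` \bigcap_l
    [set w | phi (code_cell l) (v w) == phi (code_cell l `&` A) (v w)])).
  apply: measurableU; first exact: measurableC.
  apply: measurableI => //; apply: measurable_bigcap_countType => l.
  rewrite -[X in measurable X]setTI.
  have := measurable_fun_eqr (mphi (code_cell l)) (mphi (code_cell l `&` A)).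
  by move=> /(_ measurableT [set true] I); apply.
apply/seteqP; split=> w /=.
  have [Sw|] := pselect (S (v w)); last by left.
  by move=> /(supportP _ Sw) H; right; split=> // l _ /=; apply/eqP; exact: H.
move=> [/supportN->|[Sw H]]; first by move=> j; rewrite /= inE.
by apply/(supportP _ Sw)/lives_on_cells => // l; apply/eqP; exact: (H l).
Qed.

Lemma measurable_combination q :
  measurable_fun setT (fun w => combination psi q (v w)).
Proof.
elim: q => [|x q IH].
  rewrite (_ : (fun _ => _) = cst 0); first exact: measurable_cst.
  by apply/funext => w; rewrite /combination big_nil.
rewrite (_ : (fun _ => _) =
  (fun w => x.1 * (psi x.2 (v w) : R)) \+ (fun w => combination psi q (v w))).
  apply: measurable_funD => //; apply: measurable_funM => //; exact: mphi.
by apply/funext => w; rewrite /combination big_cons.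
Qed.

(** The norm exceeds t iff one of countably many rational combinations of the
    functionals of cells exceeds t at v w and has norm at most 1 on the elements
    carried by the support of v w. The last condition depends only on the support,
    in an uncontrolled way: this is where full discreteness is needed. *)
Theorem measurable_norm_gt (t : R) :
  measurable [set w | S (v w) /\ t < `|v w|].
Proof.
have [t0|t0] := leP 0 t; last first.
  rewrite (_ : [set w | _] = v @^-1` S)//; apply/seteqP; split=> w /=; first by case.
  by move=> Sw; split=> //; exact: lt_le_trans t0 _.
pose c q g := combination psi [seq (ratr x.1, x.2) | x : rat * seq (seq bool) <- q] g.
rewrite (_ : [set w | _] = v @^-1` S `&` \bigcup_q
   ([set w | t < `|c q (v w)|] `&` (fun w => support (v w)) @^-1`
     [set T : {fset J} | forall g, S g -> lives_on g [set` T] -> `|c q g| <= `|g|])).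
  apply: measurableI => //; apply: measurable_bigcup_countType => q.
  apply: measurableI; last first.
    exact: (hit_discretely_measurable codeI KJ support_hit_measurable).
  rewrite -[X in measurable X]setTI.
  have := @measurable_fun_ltr _ _ _ _ (cst t) (fun w => `|c q (v w)|).
  move=> /(_ setT) H; apply: (H _ _ measurableT [set true] I) => //.
  by apply: measurableT_comp => //; exact: measurable_combination.
apply/seteqP; split=> w /=.
  move=> [Sw tw]; split=> //.
  by have [q [? ?]] := norming_combination Sw t0 tw; exists q.
move=> [Sw [q _ [/= tq Hq]]]; split=> //; apply: lt_le_trans tq _.
by apply: Hq => //; exact/supportP.
Qed.

End norm_measurability.

(** * The measure on the measure algebra *)

Lemma measurable_setY d (T : measurableType d) (A B : set T) :
  measurable A -> measurable B -> measurable (A `+` B).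
Proof. by move=> mA mB; apply: measurableU; exact: measurableD. Qed.

Section measure_algebra_facts.
Context d (T : measurableType d) (R : realType) (mu : probability T R).
Local Notation D := (measure_algebra mu).
Implicit Types b c : D.

Definition rep b : set T := val (repr b).

Lemma measurable_rep b : measurable (rep b).
Proof. exact: set_mem (valP (repr b)). Qed.

(** Equality modulo null sets, restricted to measurable sets. *)
Definition aeq (A B : set T) : Prop :=
  [/\ measurable A, measurable B & mu (A `+` B) = 0%E].

Lemma aeq_sym A B : aeq A B -> aeq B A.
Proof. by move=> [mA mB AB]; split=> //; rewrite setYC. Qed.

Lemma aeq_trans B A C : aeq A B -> aeq B C -> aeq A C.
Proof.
move=> [mA mB AB] [_ mC BC]; split=> //.
apply: (@subset_measure0 _ _ _ _ _ ((A `+` B) `|` (B `+` C))).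
- exact: measurable_setY.
- by apply: measurableU; exact: measurable_setY.
- by move=> x /= [] []; case: (pselect (B x)); tauto.
- apply/eqP; rewrite -measure_le0.
  rewrite (le_trans (measureU2 mu (measurable_setY mA mB) (measurable_setY mB mC)))//=.
  by rewrite AB BC adde0.
Qed.

Lemma aeq_setI A B C : measurable C -> aeq A B -> aeq (A `&` C) (B `&` C).
Proof.
move=> mC [mA mB AB]; split; [exact: measurableI..|].
apply: subset_measure0 AB; [|exact: measurable_setY|by move=> x /=; tauto].
by apply: measurable_setY; exact: measurableI.
Qed.

Lemma aeq_measure A B : aeq A B -> mu A = mu B.
Proof.
move=> [mA mB AB].
have sub (C E : set T) : measurable C -> measurable E -> mu (C `+` E) = 0%E ->
    (mu C <= mu E)%E.
  move=> mC mE CE0; rewrite (measureDI mu mC mE) -[leRHS]add0e.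
  apply: leeD; last by apply: le_measure; rewrite ?inE//; exact: measurableI.
  rewrite -CE0; apply: le_measure; rewrite ?inE; [exact: measurableD|exact: measurable_setY|].
  by move=> x ?; left.
by apply/eqP; rewrite eq_le !sub// setYC.
Qed.

Lemma rep_pi (A : set_type (@measurable d T)) :
  aeq (rep (malg_class mu A)) (val A).
Proof.
split; [exact: measurable_rep|exact: set_mem (valP A)|].
have /eqP : malg_class mu (repr (malg_class mu A)) = malg_class mu A.
  exact: reprK.
by rewrite /malg_class eqmodE => /asboolP.
Qed.

Lemma aeq_rep b c : aeq (rep b) (rep c) -> b = c.
Proof.
move=> [_ _ bc]; rewrite -[b]reprK -[c]reprK; apply/eqP; rewrite eqmodE.
exact/asboolP.
Qed.

Lemma rep_meet b c : aeq (rep (b `&` c)%O) (rep b `&` rep c).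
Proof.
have := rep_pi (msetI (repr b) (repr c)).
by rewrite [(b `&` c)%O]/(malg_meet b c) /malg_meet; unlock.
Qed.

Lemma rep_compl b : aeq (rep (~` b)%O) (~` rep b).
Proof.
have := rep_pi (msetC (repr b)).
by rewrite [(~` b)%O]/(malg_compl b) /malg_compl; unlock.
Qed.

Lemma rep_bot : aeq (rep \bot%O) set0.
Proof. exact: rep_pi (@mset0 _ T). Qed.

Lemma rep_top : aeq (rep \top%O) setT.
Proof. exact: rep_pi (@msetT _ T). Qed.

Definition malg_measure b : R := fine (mu (rep b)).

Lemma malg_measure_ge0 b : 0 <= malg_measure b.
Proof. exact/fine_ge0/measure_ge0. Qed.

Lemma malg_measure_top : malg_measure \top%O = 1.
Proof. by rewrite /malg_measure (aeq_measure rep_top) probability_setT. Qed.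

Lemma malg_measure_bot : malg_measure \bot%O = 0.
Proof. by rewrite /malg_measure (aeq_measure rep_bot) measure0. Qed.

Lemma malg_measure_eq0 b : malg_measure b = 0 -> b = \bot%O.
Proof.
move=> /eqP; rewrite /malg_measure fine_eq0 ?fin_num_measure//; last first.
  exact: measurable_rep.
move=> /eqP b0; apply: aeq_rep; apply: aeq_trans (aeq_sym rep_bot).
split=> //; first exact: measurable_rep.
by rewrite setY0.
Qed.

Lemma malg_measure_split b c :
  malg_measure b = malg_measure (b `&` c)%O + malg_measure (b `&` ~` c)%O.
Proof.
have mb := measurable_rep b; have mc := measurable_rep c.
have mnc := measurable_rep (~` c)%O.
rewrite /malg_measure (aeq_measure (rep_meet b c)).
rewrite (aeq_measure (rep_meet b (~` c)%O)).
have /aeq_measure -> : aeq (rep b `&` rep (~` c)%O) (rep b `\` rep c).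
  by rewrite setIC setDE [X in aeq _ X]setIC; apply: aeq_setI (rep_compl c).
rewrite (measureDI mu mb mc) addeC fineD// fin_num_measure//.
  exact: measurableI.
exact: measurableD.
Qed.

(** The sets that contain almost all of c form a proper filter; an ultrafilter of
    sets above it contains all conull sets, so it is compatible with equality
    modulo null sets. *)
Lemma malg_ultrafilter c : c != \bot%O ->
  exists u : set D, is_ultrafilter setT u /\ u c.
Proof.
move=> c0; pose F : set_system T := [set B | mu.-negligible (rep c `\` B)].
have FF : ProperFilter F.
  split; last first.
    split.
    - by rewrite /F /= setDT; exact: negligible_set0.
    - move=> A B FA FB; rewrite /F /= setDIr; exact: negligibleU.
    - by move=> A B AB; apply: negligibleS => x [cx nBx]; split=> // /AB.
  rewrite /F /= setD0 => /negligibleP - /(_ (measurable_rep c)) mc0.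
  move/negP: c0; apply; apply/eqP; apply: malg_measure_eq0.
  by rewrite /malg_measure mc0.
have [G [UG FG]] := ultraFilterLemma FF.
have Gaeq A B : aeq A B -> G A -> G B.
  move=> [mA mB AB] GA.
  have /(filterI GA) : G (~` (A `+` B)).
    apply: FG; rewrite /F /=; apply: (@negligibleS _ _ _ _ (A `+` B)).
      by move=> x [_ /contrapT].
    by apply/negligibleP => //; exact: measurable_setY.
  by apply: filterS => x [Ax]; apply: contra_notP => nBx; left.
exists [set b | G (rep b)]; split; last first.
  by apply: FG; rewrite /F /= setDv; exact: negligible_set0.
split=> //.
- split; first by apply: Gaeq (aeq_sym rep_top) _; exact: filterT.
  by move=> /(Gaeq _ _ rep_bot); exact: filter_not_empty.
- move=> a b Ga Gb; apply: Gaeq (aeq_sym (rep_meet a b)) _; exact: filterI.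
- move=> a b Ga _ /meet_idPl ab; move: Ga; rewrite /= -{1}ab.
  by move=> /(Gaeq _ _ (rep_meet a b)); apply: filterS => x [].
- move=> a _; have [|nGa] := in_ultra_setVsetC (rep a) UG; [left|right] => //.
  exact: Gaeq (aeq_sym (rep_compl a)) nGa.
Qed.

End measure_algebra_facts.

(** * The measure algebra has at most continuum many elements *)

Section cube.
Variable I : Type.
Local Notation cube := {ptws I -> bool}.

Lemma cube_eval_continuous (i : I) : continuous (fun x : cube => x i).
Proof. exact: (@proj_continuous {classic I} (fun _ => bool) i). Qed.

Lemma cube_nbhs_cylinder (s : seq I) (x : cube) :
  nbhs x [set y : cube | map y s = map x s].
Proof.
elim: s => [|i s IH] /=; first by apply: filterS filterT.
have xi : nbhs x [set y : cube | y i = x i].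
  by apply: (@cube_eval_continuous i x [set x i]); exact: discrete_set1.
by apply: filterS2 xi IH => y /= -> ->.
Qed.

Let supersets (s : seq I) : set (seq I) :=
  [set t | forall x y : I -> bool, map x t = map y t -> map x s = map y s].

Let supersets_cat s t : supersets (s ++ t) `<=` supersets s `&` supersets t.
Proof.
by move=> r H; split=> x y /H; rewrite !map_cat => /eqP;
  rewrite eqseq_cat ?size_map// => /andP[/eqP ? /eqP ?].
Qed.

Let finite_sets : set_system (seq I) := filter_from setT supersets.

Let finite_sets_filter : ProperFilter finite_sets.
Proof.
apply: filter_from_proper => [|s _]; last by exists s.
apply: filter_from_filter => [|s t _ _]; first by exists [::].
by exists (s ++ t) => //; exact: supersets_cat.
Qed.

(** The sets that contain a cylinder around x form a filter that converges to x
    coordinatewise, hence in the product topology. *)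
Lemma cube_cylinder_basis (x : cube) (U : set cube) : nbhs x U ->
  exists s : seq I, forall y : cube, map y s = map x s -> U y.
Proof.
pose F : set_system cube := filter_from setT
  (fun s => [set y : cube | map y s = map x s]).
have FF : Filter F.
  apply: filter_from_filter => [|s t _ _]; first by exists [::].
  exists (s ++ t) => // y /= /eqP; rewrite !map_cat.
  by rewrite eqseq_cat ?size_map// => /andP[/eqP ? /eqP ?].
suff Fx : F --> x by move=> /Fx[s _ sU]; exists s => y; exact: sU.
apply/cvg_sup => i; apply/cvg_image.
  by apply/seteqP; split=> // b _; exists (fun=> b).
move=> V; rewrite nbhs_principalE => /principal_filterP Vxi.
exists [set y : cube | V (y i)]; first by exists [:: i] => // y /= [->].
by apply/seteqP; split=> [_ [y /= Vy <-]//|b Vb]; exists (fun=> b).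
Qed.

Lemma cube_compact : compact [set: cube].
Proof.
have := @tychonoff {classic I} (fun _ => bool) (fun _ => setT) (fun _ => bool_compact).
by congr compact; apply/seteqP; split.
Qed.

(** By compactness a continuous function depends, up to e, on finitely many
    coordinates; the covering is taken along the filter of finite lists of
    coordinates, ordered by the amount of information they carry. *)
Lemma cube_uniform_continuity (R : realType) (f : cube -> R) (e : R) :
  continuous f -> 0 < e -> exists s : seq I, forall x y : cube,
    map x s = map y s -> `|f x - f y| < e.
Proof.
move=> cf e0.
have /compact_near_coveringP ncov := cube_compact.
have := ncov _ finite_sets
  (fun s x => forall y : cube, map x s = map y s -> `|f x - f y| < e)
  (@filter_filter _ _ finite_sets_filter).
case=> [x _|s _ H]; last first.
  by exists s => x y; apply: H => //; exact.
have e2 : 0 < e / 2 by rewrite divr_gt0.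
have /cvgrPdist_lt /(_ _ e2) /cube_cylinder_basis[s sU] := cf x.
exists ([set y : cube | map y s = map x s], supersets s) => /=.
  by split; [exact: cube_nbhs_cylinder|exists s].
move=> [y t] /= [yx st] z /st yz.
have h1 := sU _ yx; have h2 : `|f x - f z| < e / 2 by apply: sU; rewrite -yz.
rewrite (splitr e) (le_lt_trans _ (ltrD h1 h2))//.
have -> : f y - f z = (f x - f z) - (f x - f y) by ring.
by rewrite [leRHS]addrC ler_normB.
Qed.

End cube.

Section cylinder_approximation.
Context (R : realType) (I : Type) (lambda : probability (Baire_cube R I) R).
Local Notation cube := {ptws I -> bool}.
Local Notation BC := (Baire_cube R I).

(** A set that depends only on the finite list C.1 of coordinates. The condition on
    their values is an arbitrary predicate, so that these sets are visibly stable
    under complement. *)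
Definition cylinder (C : seq I * (seq bool -> bool)) : set BC :=
  [set x : I -> bool | C.2 (map x C.1)].

Lemma measurable_cylinder C : measurable (cylinder C).
Proof.
case: C => s; elim: s => [|i s IH] W; rewrite /cylinder /=.
  by have [W0|W0] := boolP (W [::]);
    [rewrite (_ : [set _ | _] = setT)|rewrite (_ : [set _ | _] = set0)] => //;
    apply/seteqP; split.
have mi : measurable ([set x : I -> bool | x i] : set BC).
  apply: sub_sigma_algebra; exists (fun x : cube => (x i)%:R : R).
    move=> x; apply: (@continuous_comp _ _ _ (fun x : cube => x i)
      (fun b : bool => b%:R : R)); first exact: cube_eval_continuous.
    by move=> U /nbhs_singleton Ux; rewrite nbhs_principalE /= => b ->.
  exists [set 1]; first exact: measurable_set1.
  by apply/seteqP; split=> x /=; case: (x i) => // /esym/eqP; rewrite oner_eq0.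
rewrite (_ : [set _ | _] = ([set x : I -> bool | x i] `&`
     cylinder (s, fun w => W (true :: w))) `|`
   (~` [set x : I -> bool | x i] `&` cylinder (s, fun w => W (false :: w)))).
  by apply: measurableU; apply: measurableI => //; exact: measurableC.
apply/seteqP; split=> x; rewrite /cylinder /=; case: (x i) => //.
- by left.
- by right.
- by case=> -[].
- by case=> -[].
Qed.

Definition approximable (A : set BC) : Prop := measurable A /\
  forall e : R, 0 < e -> exists C, (lambda (A `+` cylinder C) < e%:E)%E.

Lemma approximableC A : approximable A -> approximable (~` A).
Proof.
move=> [mA HA]; split; first exact: measurableC.
move=> e /HA[[s W] H]; exists (s, fun w => ~~ W w); apply: le_lt_trans H.
rewrite (_ : ~` A `+` _ = A `+` cylinder (s, W))//.
apply/seteqP; split=> x; rewrite /cylinder /=; case: (W _) => /=;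
  case: (pselect (A x)); intuition.
Qed.

Let measure_subU (A B C : set BC) : measurable A -> measurable B ->
  measurable C -> A `<=` B `|` C -> (lambda A <= lambda B + lambda C)%E.
Proof.
move=> mA mB mC ABC; apply: le_trans (measureU2 lambda mB mC).
by apply: le_measure; rewrite ?inE//; exact: measurableU.
Qed.

Lemma approximableU A B :
  approximable A -> approximable B -> approximable (A `|` B).
Proof.
move=> [mA HA] [mB HB]; split; first exact: measurableU.
move=> e e0; have e2 : 0 < e / 2 by rewrite divr_gt0.
have [[s V] HV] := HA _ e2; have [[t W] HW] := HB _ e2.
exists (s ++ t, fun w => V (take (size s) w) || W (drop (size s) w)).
rewrite (_ : cylinder _ = cylinder (s, V) `|` cylinder (t, W)); last first.
  apply/seteqP; split=> x; rewrite /cylinder /= map_cat;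
    rewrite take_size_cat ?size_map// drop_size_cat ?size_map//.
    by move=> /orP.
  by move=> /orP.
have mV := measurable_cylinder (s, V); have mW := measurable_cylinder (t, W).
rewrite (splitr e) EFinD; apply: le_lt_trans (lteD HV HW).
apply: measure_subU; [|exact: measurable_setY..|].
  by apply: measurable_setY; exact: measurableU.
by move=> x; case=> /= [] [] []; tauto.
Qed.

Lemma approximable0 : approximable set0.
Proof.
split=> // e e0; exists ([::], fun=> false).
by rewrite (_ : cylinder _ = set0) ?setYK ?measure0 ?lte_fin//; apply/seteqP; split.
Qed.

(** Continuity from below reduces to a finite union. *)
Lemma approximable_bigcup (F : nat -> set BC) :
  (forall n, approximable (F n)) -> approximable (\bigcup_n F n).
Proof.
move=> HF; have mF n : measurable (F n) by have [] := HF n.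
pose G n := \big[setU/set0]_(i < n) F i.
have HG n : approximable (G n).
  rewrite /G; elim: n => [|n IH]; first by rewrite big_ord0; exact: approximable0.
  by rewrite big_ord_recr; exact: approximableU.
have mG n : measurable (G n) by have [] := HG n.
have mU : measurable (\bigcup_n F n) by exact: bigcupT_measurable.
split=> // e e0; have e2 : 0 < e / 2 by rewrite divr_gt0.
have UG : \bigcup_n G n = \bigcup_n F n.
  apply/seteqP; split=> x [n _].
    by rewrite /G -bigcup_mkord => -[i _ Fi]; exists i.
  by move=> Fx; exists n.+1 => //; rewrite /G big_ord_recr; right.
have cvgG : lambda \o G @ \oo --> lambda (\bigcup_n F n).
  rewrite -UG; apply: nondecreasing_cvg_mu => //; first by rewrite UG.
  move=> m n mn; apply/subsetPset; rewrite /G -!bigcup_mkord.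
  by apply: bigcup_sub => i /= im x Fx; exists i => //=; exact: leq_trans im mn.
have [n Gn] : exists n, (lambda (\bigcup_n F n) - (e / 2)%:E < lambda (G n))%E.
  have lt_U : (lambda (\bigcup_n F n) - (e / 2)%:E < lambda (\bigcup_n F n))%E.
    by rewrite lteBlDr// lteDl// fin_num_measure.
  have : \forall n \near \oo, (lambda (\bigcup_n F n) - (e / 2)%:E < lambda (G n))%E.
    exact: (cvgG [set r | lambda (\bigcup_n F n) - (e / 2)%:E < r]%E (open_ereal_gt' lt_U)).
  by case=> n _ /(_ n (leqnn n)); exists n.
have [C HC] := (HG n).2 _ e2; exists C.
have mC := measurable_cylinder C.
have GU : G n `<=` \bigcup_n F n by rewrite -UG => x Gx; exists n.
have mD : measurable ((\bigcup_n F n) `\` G n) by exact: measurableD.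
have HD : (lambda ((\bigcup_n F n) `\` G n) < (e / 2)%:E)%E.
  rewrite measureD// ?fin_num_measure//; last by rewrite ltey_eq fin_num_measure.
  rewrite setIidr// lteBlDr ?fin_num_measure// addeC.
  by move: Gn; rewrite lteBlDr.
rewrite (splitr e) EFinD; apply: le_lt_trans (lteD HD HC).
apply: measure_subU => //; [exact: measurable_setY..|].
move=> x [] [/= h1 h2].
  by have [|] := pselect (G n x); [right; left|left].
by have [/GU//|h3] := pselect (G n x); right; right.
Qed.

Lemma approximable_sigma_algebra : sigma_algebra setT approximable.
Proof.
split; first exact: approximable0.
- by move=> A HA; rewrite setTD; exact: approximableC.
- exact: approximable_bigcup.
Qed.

(** The strict upper level set of f is the union over k of the cylinders of the
    points that share their relevant coordinates with some y where f exceeds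
    t + 1/(k+1), the coordinates being those that determine f up to 1/(k+1). *)
Lemma approximable_continuous_gt (f : cube -> R) (t : R) :
  continuous f -> approximable (f @^-1` `]t, +oo[ : set BC).
Proof.
move=> cf.
have k0 k : 0 < k.+1%:R^-1 :> R by rewrite invr_gt0.
have s_ k := cid (cube_uniform_continuity cf (k0 k)).
pose C k : seq I * (seq bool -> bool) := (sval (s_ k), fun w =>
  `[< exists2 y, map y (sval (s_ k)) = w & t + k.+1%:R^-1 < f y >]).
rewrite (_ : _ @^-1` _ = \bigcup_k cylinder (C k)).
  apply: approximable_bigcup => k; split; first exact: measurable_cylinder.
  by move=> e e0; exists (C k); rewrite setYK measure0 lte_fin.
apply/seteqP; split=> x; rewrite /cylinder /= in_itv /= andbT.
  move=> /ltr_add_invr[k tk]; exists k => //=; apply/asboolP; exists x => //.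
move=> [k _ /= /asboolP[y yx ty]].
have := svalP (s_ k) _ _ yx; rewrite ltr_norml => /andP[_].
by rewrite ltrBlDl => /(lt_trans ty); rewrite ltrD2r.
Qed.

Lemma measurable_approximable (A : set BC) : measurable A -> approximable A.
Proof.
apply: smallest_sub; first exact: approximable_sigma_algebra.
move=> _ [f /= cf [B mB <-]].
pose Q : set (set R) := [set B | approximable (f @^-1` B : set BC)].
suff : (measurable : set (set R)) `<=` Q by apply.
rewrite [measurable](_ : _ = (@RGenOInfty.G R).-sigma.-measurable); last first.
  exact: RGenOInfty.measurableE.
apply: smallest_sub; last by move=> _ [t ->]; exact: approximable_continuous_gt.
have [a0 aC aU] := approximable_sigma_algebra; split.
- by rewrite /Q /= preimage_set0.
- by move=> E QE; rewrite /Q /= setTD preimage_setC; exact: approximableC.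
- by move=> F QF; rewrite /Q /= preimage_bigcup; exact: aU.
Qed.

(** A class is determined by a choice, for each rational q > 0, of a cylinder at
    distance less than q. *)
Lemma small_cube_algebra : small I -> small (cube_algebra lambda).
Proof.
move=> sI; pose Cyl := (seq I * (seq bool -> bool))%type.
have sCyl : small Cyl.
  by apply: small_prod; [exact: small_seq|
    exact: (@small_countType (seq bool : countType) _ id)].
pose near_rep (b : cube_algebra lambda) (q : rat) (C : Cyl) : Prop :=
  (lambda (rep b `+` cylinder C) < (ratr q)%:E)%E.
have ex_near (p : cube_algebra lambda * rat) :
    exists C, (0 : R) < ratr p.2 -> near_rep p.1 p.2 C.
  have [q0|] := boolP ((0 : R) < ratr p.2); last by exists ([::], fun=> true).
  have [_ /(_ _ q0)[C HC]] := measurable_approximable (measurable_rep p.1).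
  by exists C.
have [approx' approxP'] := boolp.choice ex_near.
pose approx b q := approx' (b, q).
have approxP b q : (0 : R) < ratr q -> near_rep b q (approx b q).
  exact: approxP' (b, q).
apply: (@small_inj _ (rat -> Cyl) approx); last exact: small_fun.
move=> b c bc; apply: aeq_rep; have mb := measurable_rep b.
have mc := measurable_rep c; split=> //; apply/eqP; rewrite -measure_le0.
apply/lee_addgt0Pr => e e0; rewrite add0e.
have /rat_in_itvoo[q] : 0 < e / 2 :> R by rewrite divr_gt0.
rewrite in_itv /= => /andP[q0 qe].
have hb := approxP b q q0; have hc := approxP c q q0.
have mC := measurable_cylinder (approx b q).
apply: (@le_trans _ _ (lambda (rep b `+` cylinder (approx b q)) +
   lambda (rep c `+` cylinder (approx b q)))%E).
  apply: measure_subU; [exact: measurable_setY..|].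
  move=> x; rewrite /setY /=.
  by case: (pselect (cylinder (approx b q) x)); tauto.
rewrite (splitr e) EFinD; apply: leeD.
  by apply: ltW; apply: lt_trans hb _; rewrite lte_fin.
by apply: ltW; rewrite bc; apply: lt_trans hc _; rewrite lte_fin.
Qed.

End cylinder_approximation.

(** * Ultrafilter limits and atoms of finite subalgebras *)

(** The image ultrafilter clusters at a point by compactness, and an ultrafilter
    converges to its cluster points. *)
Lemma ultrafilter_bounded_cvg (R : realType) (T : Type) (U : set_system T)
    (g : T -> R) (M : R) :
  UltraFilter U -> (forall t, `|g t| <= M) -> exists l : R, g @ U --> l.
Proof.
move=> UU gM.
have [|l [_ cl]] := @segment_compact R (- M) M (g @ U) (fmap_proper_filter _ _).
  rewrite (_ : (g @ U) _ = U (g @^-1` [set` `[- M, M]]))//.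
  rewrite (_ : g @^-1` _ = setT); first exact: filterT.
  by apply/seteqP; split=> t //= _; rewrite in_itv /= -ler_norml.
exists l; apply/cvgrPdist_lt => e e0.
have [|nU] := in_ultra_setVsetC [set t | `|l - g t| < e] UU.
  by [].
have [y [h lh]] := cl _ _ (nU : (g @ U) [set r | ~ `|l - r| < e]) (nbhsx_ballx l e e0).
by exfalso; exact: h lh.
Qed.

Section atoms.
Context (disp : Order.disp_t) (D : ctbDistrLatticeType disp) (R : realType).
Local Open Scope order_scope.

(** The atoms below a of the subalgebra generated by F; repetitions and \bot may
    occur, which is harmless since \bot has measure 0. *)
Fixpoint atoms (F : seq D) (a : D) : seq D :=
  if F is b :: F' then atoms F' (a `&` b) ++ atoms F' (a `&` ~` b) else [:: a].

Lemma atoms_le F a c : c \in atoms F a -> c <= a.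
Proof.
elim: F a => [|b F IH] a /=; first by rewrite inE => /eqP ->.
by rewrite mem_cat => /orP[] /IH /le_trans; apply; exact: leIl.
Qed.

Lemma atoms_decide F a b c :
  b \in F -> c \in atoms F a -> (c <= b) || (c `&` b == \bot).
Proof.
elim: F a => [//|b' F IH] a; rewrite inE => /predU1P[<-{b'}|bF] /=; last first.
  by rewrite mem_cat => /orP[] /IH ->.
rewrite mem_cat => /orP[] /atoms_le ca.
  by rewrite (le_trans ca) ?leIr.
apply/orP; right; rewrite -lex0 -(meetxC b) meetC.
by apply: leI2 => //; exact: le_trans ca (leIr _ _).
Qed.

Lemma atoms_decide_meet (I : Type) (s : seq I) (f : I -> D) F a c :
  all (fun i => f i \in F) s -> c \in atoms F a ->
  (c <= \meet_(i <- s) f i) || (c `&` \meet_(i <- s) f i == \bot).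
Proof.
move=> + ca; elim: s => [|i s IH] /=; first by rewrite big_nil lex1.
move=> /andP[iF /IH]; rewrite big_cons lexI.
case/orP: (atoms_decide iF ca) => [->|/eqP ci _]; last first.
  by rewrite meetA ci meet0x eqxx orbT.
case/orP => [->//|/eqP cs]; apply/orP; right.
by rewrite meetCA cs meetx0.
Qed.

Variable m : D -> R.
Hypothesis m_split : forall b c, m b = (m (b `&` c) + m (b `&` ~` c))%R.

Lemma sum_atoms F a d : (\sum_(c <- atoms F a) m (c `&` d))%R = m (a `&` d).
Proof.
elim: F a => [|b F IH] a /=; first by rewrite big_seq1.
by rewrite big_cat !IH [RHS](m_split _ b) -!meetA !(meetC d).
Qed.

End atoms.

(** * Clopen sets of the Stone space and Riemann sums *)

Section Stone.
Context (disp : Order.disp_t) (D : ctbDistrLatticeType disp).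
Variables (S : set D) (algS : is_subalgebra S).
Local Notation K := (Stone_space algS).
Implicit Types (x : K) (a b : D).

Lemma Stone_meet x a b : S a -> S b ->
  val x (a `&` b)%O <-> val x a /\ val x b.
Proof.
move=> Sa Sb; have [_ _ UI Uup _] := Stone_ultrafilter x; split=> [ab|[]]; last first.
  exact: UI.
by split; apply: Uup ab _ _ => //; [exact: leIl|exact: leIr].
Qed.

Lemma Stone_compl x a : S a -> val x (~` a)%O <-> ~ val x a.
Proof.
move=> Sa; have [_ [_ U0] UI _ UC] := Stone_ultrafilter x; split=> [na xa|].
  by apply: U0; rewrite -(meetxC a); exact: UI.
by case: (UC a Sa).
Qed.

Lemma Stone_basic_open a : S a -> open (Stone_basic a : set K).
Proof.
move=> Sa; change (Stone_open (Stone_basic a : set K)) => x xa.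
by exists a; split.
Qed.

(** By compactness a clopen set is a finite union of basic ones; the covering is
    taken along the filter of finite lists of basic sets included in A. *)
Lemma Stone_clopen_cover (A : set K) : clopen A ->
  exists s : seq D, (forall a, a \in s -> S a) /\
    A = \big[setU/set0]_(a <- s) Stone_basic a.
Proof.
move=> [oA cA].
have /compact_near_coveringP covA : compact A :=
  subclosed_compact cA (@Stone_compact _ _ _ algS) (@subsetT _ A).
pose good := [set s : seq D | forall a, a \in s -> S a /\ Stone_basic a `<=` A].
pose F := filter_from good (fun s => [set t : seq D | {subset s <= t}]).
have FF : Filter F.
  apply: filter_from_filter => [|s t gs gt]; first by exists [::].
  exists (s ++ t); first by move=> a; rewrite mem_cat => /orP[/gs|/gt].
  by move=> r str; split=> a h; apply: str; rewrite mem_cat h ?orbT.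
have [x /oA[a [Sa xa aA]]|s gs sA] := covA _ F
    (fun s x => exists2 a, a \in s & Stone_basic a x) FF.
  exists (Stone_basic a, [set t : seq D | a \in t]) => /=.
    split; first by apply: open_nbhs_nbhs; split=> //; exact: Stone_basic_open.
    exists [:: a]; first by move=> b; rewrite inE => /eqP ->.
    by move=> t; apply; exact: mem_head.
  by move=> [y t] /= [ya at_]; exists a.
exists s; split; first by move=> a /gs[].
apply/seteqP; split=> x; rewrite -bigcup_seq.
  by move=> /(sA s (fun _ h => h))[a as_ xa]; exists a.
by move=> [a /= /gs[_ aA]]; exact: aA.
Qed.

End Stone.

Section riemann_sums.
Context (R : realType) (I : Type) (lambda : probability (Baire_cube R I) R).
Variable N : nonzero_cube_algebra lambda -> set nat.
Local Notation D := (cube_algebra lambda).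
Local Notation J := (nonzero_cube_algebra lambda).
Local Notation K := (N_Stone N).
Local Notation m := (@malg_measure _ _ _ lambda).
Implicit Types (s : {fset J}) (X : set J).

Lemma N_generator_alg b : N_algebra N (N_generator N b).
Proof. by move=> A [_]; apply; exists b. Qed.

(** The indicator of the meet of the generators G_b, b in s. *)
Definition mono s (x : K) : bool := `[< forall b, b \in s -> val x (N_generator N b) >].

Lemma monoU s t x : mono (s `|` t)%fset x = mono s x && mono t x.
Proof.
apply/asboolP/andP => [H|[/asboolP Hs /asboolP Ht] b].
  by split; apply/asboolP => b bs; apply: H; rewrite inE bs ?orbT.
by rewrite inE => /orP[]; [exact: Hs|exact: Ht].
Qed.

Definition meet_fset s : D := (\meet_(b <- enum_fset s) val b)%O.

(** Coordinatewise G_b is at most b, so the meet of the G_b vanishes when the meet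
    of the b does. *)
Lemma mono_meet_neq0 s x : mono s x -> meet_fset s != \bot%O.
Proof.
move=> /asboolP sx.
have [[U_S [U1 U0] UI Uup UC] [_ S1 SI _ _]] := (Stone_ultrafilter x, N_algebraP N).
pose g := (\meet_(b <- enum_fset s) N_generator N b)%O.
have xg : val x g.
  rewrite /g; have : {subset enum_fset s <= s} by [].
  elim: (enum_fset s) => [|b t IH] ts; first by rewrite big_nil.
  rewrite big_cons; apply: UI; first by apply: sx; apply: ts; exact: mem_head.
  by apply: IH => c ct; apply: ts; rewrite inE ct orbT.
apply/negP => /eqP s0; apply: U0; suff <- : g = \bot%O by [].
apply/funext => n; apply/eqP; rewrite -lex0.
change (g n <= (\bot : D))%O; rewrite -s0 /g /meet_fset.
elim: (enum_fset s) => [|b t IH]; first by rewrite !big_nil lex1.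
rewrite !big_cons; apply: leI2; last exact: IH.
by rewrite /N_generator; case: ifP.
Qed.

Lemma tag_exists (c : D) : exists u : set D,
  is_ultrafilter setT u /\ (c != \bot%O -> u c).
Proof.
have [c0|c0] := eqVneq c \bot%O; last first.
  by have [u [uU uc]] := malg_ultrafilter c0; exists u.
have /malg_ultrafilter[u [uU _]] : (\top : D)%O != \bot%O.
  apply/negP => /eqP H; have := malg_measure_top lambda.
  by rewrite H malg_measure_bot => /esym/eqP; rewrite oner_eq0.
by exists u; split.
Qed.

(** A chosen ultrafilter of the measure algebra that contains c when c is nonzero. *)
Definition tag_ultrafilter (c : D) : set D := sval (cid (tag_exists c)).

Lemma tag_ultrafilterP c : is_ultrafilter setT (tag_ultrafilter c) /\
  (c != \bot%O -> tag_ultrafilter c c).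
Proof. exact: svalP (cid (tag_exists c)). Qed.

Lemma slice_ultrafilter (u : set D) n : is_ultrafilter setT u ->
  is_ultrafilter (N_algebra N) [set a | N_algebra N a /\ u (a n)].
Proof.
move=> [_ [u1 u0] uI uup uC]; have [_ S1 SI _ SC] := N_algebraP N; split.
- by move=> a [].
- by split => // -[].
- by move=> a b [Sa ua] [Sb ub]; split; [exact: SI|exact: uI].
- move=> a b [Sa ua] Sb ab; split=> //; apply: uup ua _ _ => //.
  by move/asboolP: ab; exact.
- move=> a Sa; have [ua|ua] := uC (a n) Logic.I; [left|right]; split=> //.
  exact: SC.
Qed.

(** An ultrafilter of D, applied to the n-th coordinate, is a point of K. *)
Definition tag (n : nat) (c : D) : K :=
  exist (fun U : set (power_algebra D) => `[< is_ultrafilter (N_algebra N) U >]) _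
    (asboolT (slice_ultrafilter n (tag_ultrafilterP c).1)).

(** A Riemann sum for the measure of the n-th coordinate, p = (n, F): one tag for
    each atom of the subalgebra generated by F. *)
Definition riemann_sum (p : nat * seq D) (f : K -> R) : R :=
  \sum_(c <- atoms p.2 \top%O) m c * f (tag p.1 c).

Lemma riemann_sum_le p f M : (forall x, `|f x| <= M) -> `|riemann_sum p f| <= M.
Proof.
move=> fM; rewrite /riemann_sum (le_trans (ler_norm_sum _ _ _))//.
have <- : \sum_(c <- atoms p.2 \top%O) m (c `&` \top)%O * M = M.
  rewrite -mulr_suml (sum_atoms (@malg_measure_split _ _ _ lambda)) meetxx.
  by rewrite malg_measure_top mul1r.
apply: ler_sum => c _; rewrite meetx1 normrM ger0_norm ?malg_measure_ge0//.
by rewrite ler_wpM2l// malg_measure_ge0.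
Qed.

(** The pairs (n, F) that are late enough for s: F contains the elements of s, and
    n sees exactly those of them that are in X. *)
Definition tail X s : set (nat * seq D) :=
  [set p : nat * seq D | forall b, b \in s -> val b \in p.2 /\ (N b p.1 <-> X b)].

Definition mass X s : R := if `[< [set` s] `<=` X >] then m (meet_fset s) else 0.

(** For a late pair the Riemann sum of a monomial is exact. If s is included in X
    then the n-th coordinate of G_s is the meet of s, and each atom is included in
    it or disjoint from it; otherwise the n-th coordinate of G_s is \bot. *)
Lemma riemann_sum_mono X s p : tail X s p ->
  riemann_sum p (fun x => (mono s x)%:R) = mass X s.
Proof.
case: p => n F sp; rewrite /riemann_sum /mass /=.
have tag_gen c b : val (tag n c) (N_generator N b) <->
    tag_ultrafilter c (N_generator N b n).
  by split=> [[]//|uc]; split=> //; exact: N_generator_alg.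
case: asboolP => [sX|nsX]; last first.
  apply: big1_seq => c _; rewrite /mono; case: asboolP => [sc|_]; last by rewrite mulr0.
  exfalso; apply: nsX => b bs; apply: contrapT => nXb.
  have /tag_gen := sc b bs; rewrite /N_generator.
  have [_ Nb] := sp b bs; rewrite memNset; last by move/Nb.
  by have [[_ [_ u0] _ _ _] _] := tag_ultrafilterP c.
rewrite -[meet_fset s]meet1x -(sum_atoms (@malg_measure_split _ _ _ lambda) F).
apply: eq_big_seq => c cF.
have gen b : b \in s -> N_generator N b n = val b.
  by move=> bs; rewrite /N_generator mem_set//; have [_ ->] := sp b bs; exact: sX.
have [[_ [u1 u0] uI uup _] uc] := tag_ultrafilterP c.
have monoE : mono s (tag n c) <-> tag_ultrafilter c (meet_fset s).
  rewrite /mono; split=> [/asboolP H|H].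
    rewrite /meet_fset; have : {subset enum_fset s <= s} by [].
    elim: (enum_fset s) => [|b t IH] ts; first by rewrite big_nil.
    have bs : b \in s by apply: ts; exact: mem_head.
    rewrite big_cons; apply: uI; first by rewrite -gen//; exact/tag_gen/H.
    by apply: IH => d dt; apply: ts; rewrite inE dt orbT.
  apply/asboolP => b bs; apply/tag_gen; rewrite gen//.
  apply: uup H _ _ => //; rewrite /meet_fset (big_rem b)//=.
  exact: leIl.
have : all (fun b : J => val b \in F) (enum_fset s).
  by apply/allP => b bs; have [] := sp b bs.
move=> /atoms_decide_meet/(_ cF); rewrite -/(meet_fset s).
have [->|c0] := eqVneq c \bot%O; first by rewrite meet0x malg_measure_bot mul0r.
case/orP => [cs|/eqP cs].
  have -> : mono s (tag n c) by apply/monoE; apply: uup (uc c0) _ _.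
  by rewrite mulr1; move/meet_idPl: cs => ->.
rewrite cs malg_measure_bot; case: (boolP (mono _ _)) => [|_]; last by rewrite mulr0.
move=> /monoE H; exfalso; apply: u0; rewrite -cs; apply: uI => //; exact: uc.
Qed.

End riemann_sums.

(** * The functional attached to a set of generators *)

Section tail_integrals.
Context (R : realType) (I : Type) (lambda : probability (Baire_cube R I) R).
Variable N : nonzero_cube_algebra lambda -> set nat.
Hypothesis N_independent : independent_family N.
Local Notation D := (cube_algebra lambda).
Local Notation J := (nonzero_cube_algebra lambda).
Local Notation K := (N_Stone N).
Local Notation m := (@malg_measure _ _ _ lambda).
Implicit Types (s : {fset J}) (X : set J).

(** Independence of N provides an n for every pattern on a finite set s. *)
Lemma tail_filter X : ProperFilter (filter_from setT (@tail _ _ _ N X)).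
Proof.
apply: filter_from_proper => [|s _].
  apply: filter_from_filter => [|s t _ _]; first by exists fset0.
  exists (s `|` t)%fset => // p H.
  by split=> b bs; apply: H; rewrite inE bs ?orbT.
have [n [nX nnX]] : (\bigcap_(b in [set` s] `&` X) N b) `\`
    (\bigcup_(b in [set` s] `\` X) N b) !=set0.
  apply: N_independent.
  - by apply: finite_setIl; exact: finite_fset.
  - by apply: finite_setD; exact: finite_fset.
  - by apply/seteqP; split=> b //= [[_ ?] [_ ?]].
exists (n, map val (enum_fset s)) => b bs /=; split; first exact: map_f.
split=> [nb|Xb]; last exact: nX.
by apply: contrapT => nXb; apply: nnX; exists b.
Qed.

Definition tail_ultrafilter X : set_system (nat * seq D) :=
  sval (cid (@ultraFilterLemma _ _ (tail_filter X))).

Lemma tail_ultrafilter_ultra X : UltraFilter (tail_ultrafilter X).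
Proof. exact: (svalP (cid (@ultraFilterLemma _ _ (tail_filter X)))).1. Qed.

Lemma tail_ultrafilter_tail X s : tail_ultrafilter X (@tail _ _ _ N X s).
Proof.
by apply: (svalP (cid (@ultraFilterLemma _ _ (tail_filter X)))).2; exists s.
Qed.

Lemma riemann_sum_linear p a (f g : K -> R) :
  riemann_sum p (fun x => a * f x + g x) = a * riemann_sum p f + riemann_sum p g.
Proof.
rewrite /riemann_sum mulr_sumr -big_split /=; apply: eq_bigr => c _.
by rewrite mulrDr mulrCA.
Qed.

Lemma tail_integral_exists X (f : N_C N) : exists l : R,
  (fun p => riemann_sum p (val f : K -> R)) @ tail_ultrafilter X --> l.
Proof.
apply: (@ultrafilter_bounded_cvg _ _ _ _ (sup_norm f)).
  exact: tail_ultrafilter_ultra.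
by move=> p; apply: riemann_sum_le => x; exact: sup_norm_ge.
Qed.

(** The functional phi_X. Taking the limit along an ultrafilter makes it defined
    and linear on all of C(K), with no need to prove that the Riemann sums of a
    continuous function converge along a filter of partitions. *)
Definition tail_integral X (f : N_C N) : R^o := sval (cid (tail_integral_exists X f)).

Lemma tail_integralP X (f : N_C N) :
  (fun p => riemann_sum p (val f : K -> R)) @ tail_ultrafilter X
    --> (tail_integral X f : R).
Proof. exact: svalP (cid (tail_integral_exists X f)). Qed.

Lemma tail_integralE X (f : N_C N) (l : R) :
  (fun p => riemann_sum p (val f : K -> R)) @ tail_ultrafilter X --> l ->
  tail_integral X f = l.
Proof.
have UU := tail_ultrafilter_ultra X.
by move=> H; exact: (norm_cvg_unique (@tail_integralP X f) H).
Qed.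

Lemma tail_integral_linear X : linear (tail_integral X).
Proof.
move=> a f g; have UU := tail_ultrafilter_ultra X; apply: tail_integralE.
rewrite (_ : (fun p => _) = (fun p => a * riemann_sum p (val f : K -> R) +
    riemann_sum p (val g : K -> R))).
  by apply: cvgD (@tail_integralP X g); apply: cvgMl_tmp; exact: tail_integralP.
by apply/funext => p; rewrite -riemann_sum_linear.
Qed.

HB.instance Definition _ X :=
  GRing.isLinear.Build R (N_C N) R^o *:%R (tail_integral X) (tail_integral_linear X).

Lemma tail_integral_le X (f : N_C N) : `|tail_integral X f : R| <= `|f|.
Proof.
have UU := tail_ultrafilter_ultra X.
have fM p : `|riemann_sum p (val f : K -> R)| <= `|f|.
  by apply: riemann_sum_le => x; exact: sup_norm_ge.
apply: (cvgr_to_le (cvg_norm (@tail_integralP X f))); exact: nearW.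
Qed.

Lemma riemann_sum_combination_cvg X (l : seq ({fset J} * R)) :
  (fun p => riemann_sum p (fun x : K => \sum_(q <- l) q.2 * (mono q.1 x)%:R))
    @ tail_ultrafilter X --> \sum_(q <- l) q.2 * mass X q.1.
Proof.
have UU := tail_ultrafilter_ultra X.
elim: l => [|q l IH].
  rewrite big_nil (_ : (fun _ => _) = cst 0); first exact: cvg_cst.
  by apply/funext => p; rewrite /riemann_sum big1// => c _; rewrite big_nil mulr0.
rewrite big_cons (_ : (fun _ => _) = (fun p =>
    q.2 * riemann_sum p (fun x : K => (mono q.1 x)%:R) +
    riemann_sum p (fun x : K => \sum_(q <- l) q.2 * (mono q.1 x)%:R))).
  apply: cvgD IH; apply: cvgMl_tmp; apply: cvg_near_cst.
  apply: filterS (tail_ultrafilter_tail X q.1) => p.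
  exact: riemann_sum_mono.
apply/funext => p; rewrite -riemann_sum_linear; congr riemann_sum.
by apply/funext => x; rewrite big_cons.
Qed.

Lemma tail_integral_combination X (f : N_C N) (l : seq ({fset J} * R)) :
  (forall x, val f x = \sum_(q <- l) q.2 * (mono q.1 x)%:R) ->
  tail_integral X f = \sum_(q <- l) q.2 * mass X q.1.
Proof.
move=> /funext fl; apply: tail_integralE; rewrite fl.
exact: riemann_sum_combination_cvg.
Qed.

End tail_integrals.

(** * Simple functions and their norm *)

Lemma contraction_continuous (R : realType) (V : normedModType R)
    (phi : {linear V -> R^o}) :
  (forall g, `|phi g : R| <= `|g|) -> continuous phi.
Proof.
move=> phi_le f; apply/cvgrPdist_lt => e e0; apply/nbhs_normP; exists e => //= g fg.
by rewrite -linearB; exact: le_lt_trans (phi_le _) fg.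
Qed.

(** The topology is initial for the pairing, and phi is a coordinate of it. *)
Lemma dual_weakly_continuous (R : realType) (V : normedModType R)
    (phi : {linear V -> R^o}) :
  continuous phi -> continuous (phi : weakly_topologized V -> R).
Proof.
move=> cphi.
pose delta : dual_space V :=
  exist (fun psi : {linear V -> R^o} => `[< continuous psi >]) phi (asboolT cphi).
move=> f; apply: (@continuous_comp (weakly_topologized V)
  {ptws dual_space V -> R^o} R (@dual_pairing R V) (fun g => g delta)).
  exact: initial_continuous.
exact: (@proj_continuous {classic dual_space V} (fun _ => R^o) delta).
Qed.

Section simple_functions.
Context (R : realType) (I : Type) (lambda : probability (Baire_cube R I) R).
Variable N : nonzero_cube_algebra lambda -> set nat.
Hypothesis N_independent : independent_family N.
Local Notation D := (cube_algebra lambda).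
Local Notation J := (nonzero_cube_algebra lambda).
Local Notation K := (N_Stone N).
Local Notation m := (@malg_measure _ _ _ lambda).
Local Notation tail_integral := (tail_integral N_independent).
Implicit Types (s : {fset J}) (X : set J).

Definition polynomial (h : K -> R) : Prop :=
  exists l : seq ({fset J} * R), forall x, h x = \sum_(q <- l) q.2 * (mono q.1 x)%:R.

Lemma polynomial0 : polynomial (fun=> 0).
Proof. by exists [::] => x; rewrite big_nil. Qed.

Lemma polynomial1 : polynomial (fun=> 1).
Proof.
exists [:: (fset0, 1)] => x; rewrite big_seq1 mul1r /mono.
by case: asboolP => // -[] b; rewrite inE.
Qed.

Lemma polynomialD f g : polynomial f -> polynomial g ->
  polynomial (fun x => f x + g x).
Proof. by move=> [k fk] [l gl]; exists (k ++ l) => x; rewrite big_cat -fk -gl. Qed.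

Lemma polynomialZ a f : polynomial f -> polynomial (fun x => a * f x).
Proof.
move=> [k fk]; exists [seq (q.1, a * q.2) | q <- k] => x.
by rewrite big_map fk mulr_sumr; apply: eq_bigr => q _; rewrite mulrA.
Qed.

Lemma polynomial_mono_mul s f : polynomial f ->
  polynomial (fun x => (mono s x)%:R * f x).
Proof.
move=> [k fk]; exists [seq ((s `|` q.1)%fset, q.2) | q <- k] => x.
rewrite big_map fk mulr_sumr; apply: eq_bigr => q _ /=.
by rewrite monoU -mulnb natrM mulrCA.
Qed.

Lemma polynomialM f g : polynomial f -> polynomial g ->
  polynomial (fun x => f x * g x).
Proof.
move=> [k /funext ->] pg; elim: k => [|q k IH].
  rewrite (_ : (fun _ => _) = (fun=> 0)); first exact: polynomial0.
  by apply/funext => x; rewrite big_nil mul0r.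
rewrite (_ : (fun _ => _) = (fun x => q.2 * ((mono q.1 x)%:R * g x) +
  (\sum_(q <- k) q.2 * (mono q.1 x)%:R) * g x)).
  by apply: polynomialD => //; apply/polynomialZ/polynomial_mono_mul.
by apply/funext => x; rewrite big_cons mulrDl mulrA.
Qed.

Definition polynomial_set (A : set K) : Prop := polynomial (\1_A : K -> R).

Lemma polynomial_set0 : polynomial_set set0.
Proof. by rewrite /polynomial_set indic0; exact: polynomial0. Qed.

Lemma polynomial_setI A B :
  polynomial_set A -> polynomial_set B -> polynomial_set (A `&` B).
Proof. by move=> pA pB; rewrite /polynomial_set indicI; exact: polynomialM. Qed.

Lemma polynomial_setC A : polynomial_set A -> polynomial_set (~` A).
Proof.
move=> pA; rewrite /polynomial_set (_ : \1_(~` A) = fun x => 1 + -1 * \1_A x).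
  by apply: polynomialD; [exact: polynomial1|exact: polynomialZ].
apply/funext => x; rewrite !indicE in_setC.
by case: (x \in A) => /=; rewrite ?mulr1 ?mulr0 ?subrr ?addr0.
Qed.

Lemma polynomial_setU A B :
  polynomial_set A -> polynomial_set B -> polynomial_set (A `|` B).
Proof.
move=> pA pB; rewrite -[A `|` B]setCK setCU; apply: polynomial_setC.
by apply: polynomial_setI; exact: polynomial_setC.
Qed.

(** The elements whose basic set has a polynomial indicator form a subalgebra
    containing the generators. *)
Lemma polynomial_Stone_basic a : N_algebra N a ->
  polynomial_set (Stone_basic a : set K).
Proof.
move=> Na; have [S0 S1 SI SU SC] := N_algebraP N.
pose good := [set a | N_algebra N a /\ polynomial_set (Stone_basic a : set K)].
have [] // : good a.
have SbI b c : N_algebra N b -> N_algebra N c ->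
    (Stone_basic (b `&` c)%O : set K) = Stone_basic b `&` Stone_basic c.
  by move=> Nb Nc; apply/seteqP; split=> x /(Stone_meet _ Nb Nc).
have SbC b : N_algebra N b -> (Stone_basic (~` b)%O : set K) = ~` Stone_basic b.
  by move=> Nb; apply/seteqP; split=> x /(Stone_compl _ Nb).
have goodI b c : good b -> good c -> good (b `&` c)%O.
  move=> [Nb pb] [Nc pc]; split; first exact: SI.
  by rewrite SbI//; exact: polynomial_setI.
have goodC b : good b -> good (~` b)%O.
  by move=> [Nb pb]; split; [exact: SC|rewrite SbC//; exact: polynomial_setC].
have good0 : good \bot%O.
  split=> //; rewrite (_ : Stone_basic _ = set0); first exact: polynomial_set0.
  by rewrite -subset0 => x; have [_ []] := Stone_ultrafilter x.
apply: Na; split; last first.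
  move=> _ [b _ <-]; split; first exact: N_generator_alg.
  exists [:: ([fset b]%fset, 1)] => x; rewrite big_seq1 mul1r indicE /mono.
  congr (_ _)%:R; apply/idP/asboolP => [/set_mem xb c|H].
    by move=> /fset1P ->.
  by apply/mem_set/H; exact: fset11.
split=> //.
- by rewrite -compl0; exact: goodC.
- move=> b c gb gc; rewrite -[(b `|` c)%O]complK complU.
  by apply: (goodC); apply: goodI; exact: goodC.
Qed.

Lemma polynomial_clopen (A : set K) : clopen A -> polynomial_set A.
Proof.
move=> /Stone_clopen_cover[s [Ns ->]].
elim: s Ns => [|a s IH] Ns; first by rewrite big_nil; exact: polynomial_set0.
rewrite big_cons; apply: polynomial_setU.
  by apply: polynomial_Stone_basic; apply: Ns; exact: mem_head.
by apply: IH => b bs; apply: Ns; rewrite inE bs orbT.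
Qed.

Lemma polynomial_N_S (f : N_C N) : N_S N f -> polynomial (val f : K -> R).
Proof.
move=> [n [r [g [Hg ->]]]]; elim: n r g Hg => [|n IH] r g Hg.
  by rewrite big_ord0; exact: polynomial0.
rewrite big_ord_recl; apply: polynomialD; last exact: IH.
have [A cA gA] := Hg ord0; apply: polynomialZ; rewrite gA.
exact: polynomial_clopen.
Qed.

Lemma N_S_lin a (f g : N_C N) : N_S N f -> N_S N g -> N_S N (a *: f + g).
Proof.
move=> [n [r [f' [Hf ->]]]] [k [t [g' [Hg ->]]]].
exists (n + k)%N, 
  (fun i => match fintype.split i with inl i => a * r i | inr i => t i end),
  (fun i => match fintype.split i with inl i => f' i | inr i => g' i end).
split=> [i|]; first by case: (fintype.split i).
rewrite big_split_ord scaler_sumr; congr +%R; apply: eq_bigr => i _.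
  by rewrite (unsplitK (inl i)) scalerA.
by rewrite (unsplitK (inr i)).
Qed.

Lemma tail_integral_finite_support (f : N_C N) : N_S N f ->
  exists T : {fset J}, forall X, tail_integral X f = tail_integral (X `&` [set` T]) f.
Proof.
move=> /polynomial_N_S[l fl].
exists (\bigcup_(q <- l) q.1)%fset => X; rewrite !(tail_integral_combination _ _ fl).
apply: eq_big_seq => q ql; congr (_ * _); rewrite /mass.
congr (if _ then _ else _); apply/asbool_equiv_eq; split=> H b bq; last exact: (H b bq).1.
split; first exact: H.
by apply/bigfcupP; exists q => //; rewrite ql.
Qed.

(** Induction on the number of terms. For s of minimal cardinality, taking X = s
    kills all monomials other than s, so the total coefficient of s times the
    measure of the meet of s is 0. If that measure is 0 the monomial itself is 0;
    in both cases the terms with monomial s can be removed. *)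
Lemma mono_independent (l : seq ({fset J} * R)) :
  (forall X, \sum_(q <- l) q.2 * mass X q.1 = 0) ->
  forall x : K, \sum_(q <- l) q.2 * (mono q.1 x)%:R = 0.
Proof.
move: {2}(size l) (leqnn (size l)) => n; elim: n l => [|n IH] l.
  by rewrite leqn0 => /nilP -> _ x; rewrite big_nil.
move=> ln H x; have [->|l0] := eqVneq l [::]; first by rewrite big_nil.
have [q0 q0l] : exists q, q \in l.
  by case: l l0 {H ln} => [//|q l' _]; exists q; exact: mem_head.
pose P k := `[< exists2 q, q \in l & #|` q.1| = k >].
have exP : exists k, P k by exists #|` q0.1|; apply/asboolP; exists q0.
have [k /asboolP[[s r] sl /= sk] kmin] := ex_minnP exP.
have smin q : q \in l -> (#|` s| <= #|` q.1|)%N.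
  by move=> ql; rewrite sk; apply: kmin; apply/asboolP; exists q.
pose l2 := [seq q <- l | q.1 != s].
have splitE (F : {fset J} -> R) : \sum_(q <- l) q.2 * F q.1 =
    (\sum_(q <- l | q.1 == s) q.2) * F s + \sum_(q <- l2) q.2 * F q.1.
  rewrite (bigID (fun q => q.1 == s)) /= big_filter mulr_suml; congr +%R.
  by apply: eq_bigr => q /eqP ->.
(* A monomial q included in s has at least as many elements, so it equals s. *)
have s0 : (\sum_(q <- l | q.1 == s) q.2) * m (meet_fset s) = 0.
  have -> : m (meet_fset s) = mass [set` s] s by rewrite /mass asboolT.
  have := H [set` s]; rewrite splitE [X in _ + X]big1_seq ?addr0// => q.
  rewrite mem_filter => /andP[_ /andP[qs ql]].
  rewrite /mass; case: asboolP => [qsub|_]; last by rewrite mulr0.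
  case/eqP: qs; apply/eqP; rewrite eqEfcard smin// andbT.
  by apply/fsubsetP.
have coef X : (\sum_(q <- l | q.1 == s) q.2) * mass X s = 0.
  by rewrite /mass; case: asboolP; rewrite ?mulr0.
rewrite (splitE (fun s => (mono s x)%:R)) IH ?addr0; last first.
- by move=> X; have := H X; rewrite (splitE (mass X)) coef add0r.
- rewrite -ltnS (leq_trans _ ln)// size_filter.
  rewrite -(count_predC (fun q : {fset J} * R => q.1 == s) l).
  rewrite -[X in (X < _)%N]add0n ltn_add2r -has_count.
  by apply/hasP; exists (s, r) => /=.
case: (boolP (mono s x)) => [/mono_meet_neq0 sx|]; last by rewrite mulr0.
move: s0 => /eqP; rewrite mulf_eq0 => /orP[/eqP ->|/eqP]; first by rewrite mul0r.
by move=> /malg_measure_eq0/eqP; rewrite (negbTE sx).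
Qed.

Lemma tail_integral_separates (f : N_C N) :
  N_S N f -> (forall X, tail_integral X f = 0) -> f = 0.
Proof.
move=> /polynomial_N_S[l fl] f0; apply: val_inj; apply/funext => x.
rewrite [LHS](fl x); apply: mono_independent => X.
by rewrite -(tail_integral_combination _ _ fl) f0.
Qed.

Definition evaluation (x : K) (f : N_C N) : R^o := val f x.

Lemma evaluation_linear x : linear (evaluation x).
Proof. by []. Qed.

HB.instance Definition _ x :=
  GRing.isLinear.Build R (N_C N) R^o *:%R (evaluation x) (evaluation_linear x).

Lemma evaluation_norming (f : N_C N) (t : R) : N_S N f -> 0 <= t -> t < `|f| ->
  exists2 delta : {linear N_C N -> R^o},
    (forall g, `|delta g : R| <= `|g|) & t < `|delta f : R|.
Proof.
move=> _ t0 tf; have [x fx] : exists x, t < `|val f x : R|.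
  apply: contrapT => /forallNP H; move: tf; apply/negP; rewrite -leNgt.
  by apply: sup_norm_le => // x; rewrite leNgt; apply/negP/H.
exists (evaluation x : {linear N_C N -> R^o}) => // g; exact: sup_norm_ge.
Qed.

(** The sigma-algebra on C(K) that makes the trace on S(K) measurable in the usual
    sense: everything outside S(K) is declared measurable. *)
Definition trace_class : set (set (N_C N)) :=
  [set A | exists2 W, weak_Baire (N_C N) W & W `&` N_S N = A `&` N_S N].

Lemma trace_class_sigma_algebra : sigma_algebra setT trace_class.
Proof.
have [W0 WC WU] := smallest_sigma_algebra setT
  (Baire_generator R (weakly_topologized (N_C N))).
split.
- by exists set0.
- move=> A [W wW WA]; exists (setT `\` W); first exact: WC.
  apply/seteqP; split=> f [[_ nf] Sf]; split=> //; split=> // Xf; apply: nf.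
    by have [] : (W `&` N_S N) f by rewrite WA.
  by have [] : (A `&` N_S N) f by rewrite -WA.
- move=> F FT; pose w n := sval (cid2 (FT n)).
  exists (\bigcup_n w n).
    by apply: WU => n; rewrite /w; case: cid2.
  rewrite !setI_bigcupl; apply: eq_bigcupr => n _.
  by rewrite /w; case: cid2.
Qed.

Lemma measurable_tail_integral X :
  measurable_fun setT (fun f : g_sigma_algebraType trace_class =>
    tail_integral X f : R).
Proof.
move=> _ B mB; rewrite setTI; apply: sub_sigma_algebra.
exists (tail_integral X @^-1` B) => //; apply: sub_sigma_algebra.
exists (tail_integral X : weakly_topologized (N_C N) -> R).
  apply: dual_weakly_continuous; apply: contraction_continuous.
  exact: tail_integral_le.
by exists B.
Qed.

End simple_functions.

Theorem theorem3p22 (R : realType) (I : Type)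
    (omega1_le_kappa : ~ countable [set: I])
    (kappa_le_c : ([set: I] #<= [set: R])%card)
    (lambda : probability (Baire_cube R I) R)
    (lambda_product : usual_product_measure lambda)
    (N : nonzero_cube_algebra lambda -> set nat)
    (N_independent : independent_family N)
    (c_Kunen : Kunen_cardinal R) :
  preimage_set_system (N_S N) (fun f : N_C N => `|f|)
      (measurable : set (set R))
    `<=` strace (weak_Baire (N_C N)) (N_S N).
Proof.
have sI : small I.
  have /pcard_leP/unsquash i := kappa_le_c.
  by apply: (@small_inj _ _ i) (small_real R) => x y; apply: 'inj_i; rewrite inE.
have sJ : small (nonzero_cube_algebra lambda).
  exact: (@small_inj _ _ val val_inj (small_cube_algebra lambda sI)).
have [code codeI] := sJ.
have KJ := Kunen_small c_Kunen (small_fset sJ).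
have sT := @trace_class_sigma_algebra R I lambda N.
have mS : measurable (N_S N : set (g_sigma_algebraType (@trace_class R I lambda N))).
  apply: sub_sigma_algebra; exists setT; last by rewrite setTI setIid.
  exact: (@measurableT _ (g_sigma_algebraType
    (Baire_generator R (weakly_topologized (N_C N))))).
have mgt (t : R) : @trace_class R I lambda N [set f : N_C N | t < `|f|].
  have := @measurable_norm_gt R (N_C N) _ code (N_S N)
    (fun X => tail_integral N_independent X) codeI KJ (@N_S_lin _ _ _ N)
    (@tail_integral_le _ _ _ N N_independent)
    (@tail_integral_finite_support _ _ _ N N_independent)
    (@tail_integral_separates _ _ _ N N_independent)
    (@evaluation_norming _ _ _ N) _
    (g_sigma_algebraType (@trace_class R I lambda N)) id mS
    (@measurable_tail_integral _ _ _ N N_independent) t.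
  rewrite /measurable /= sigma_algebra_id// => -[W wW WE].
  exists W => //; rewrite WE; apply/seteqP; split=> f /=; first by case=> -[].
  by case.
move=> _ [B mB <-].
pose Q := [set B : set R | @trace_class R I lambda N [set f : N_C N | B `|f|]].
have : Q B.
  have [Q0 QC QU] := sT.
  move: B mB; rewrite [measurable](_ : _ = (@RGenOInfty.G R).-sigma.-measurable); last first.
    exact: RGenOInfty.measurableE.
  apply: smallest_sub; last first.
    move=> _ [t ->]; rewrite /Q /=; have := mgt t; congr trace_class.
    by apply/seteqP; split=> f; rewrite /= in_itv /= andbT.
  split; first exact: Q0.
  - by move=> A /QC; congr trace_class; apply/seteqP; split.
  - by move=> F /QU; congr trace_class; apply/seteqP; split.
move=> [W wW WB]; exists W => //; rewrite WB.
by rewrite setIC.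
Qed.
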